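(* Let $K$ be a field and $E$ a directed graph (of arbitrary cardinality). Then $L_K(E)$ is an exchange ring if and only if $E$ satisfies Condition (K).
   Context: A (directed) graph $E=(E^0,E^1,r,s)$ consists of two disjoint sets $E^0$ (vertices), $E^1$ (edges) and maps $r,s:E^1\to E^0$ (range and source). A vertex $v$ is a sink if $s^{-1}(v)=\varnothing$, and an infinite emitter if $s^{-1}(v)$ is infinite. The double $\widehat E$ of $E$ has $\widehat E^0=E^0$ and $\widehat E^1=E^1\sqcup\{e^*\mid e\in E^1\}$, with $r(e^* )=s(e)$, $s(e^* )=r(e)$. Paths are written left to right: $e_1e_2\cdots e_n$ with $r(e_i)=s(e_{i+1})$; there is also a path $v$ of length zero at each vertex $v$. The path algebra $K\widehat E$ is the $K$-vector space with basis all paths in $\widehat E$, with multiplication given by concatenation when range and source match, and $0$ otherwise. The Leavitt path algebra $L_K(E)$ is the (not necessarily unital) quotient of $K\widehat E$ by the ideal generated by: $e^*e-r(e)$ for all $e\in E^1$; $e^*f$ for all distinct $e,f\in E^1$; and $v-\sum_{e\in E^1,\,s(e)=v}ee^*$ for every $v\in E^0$ which is neither a sink nor an infinite emitter. A (not necessarily unital) ring $R$ is an exchange ring if for each $x\in R$ there exist elements $e,r,s\in R$ such that $e$ is an idempotent and $e=xr=x+s-xs$. A path $p=e_1e_2\cdots e_n$ ($n\ge1$) in $E$ is closed if $r(e_n)=s(e_1)$, in which case it is based at $s(e_1)$; a closed path $p$ is simple if $s(e_i)\ne s(e_1)$ for all $i=2,\dots,n$. The graph $E$ satisfies Condition (K)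 if no vertex of $E$ is the base of precisely one simple closed path in $E$. *)

(* Defs.v *)
From HB Require Import structures.
From mathcomp Require Import all_boot all_algebra generic_quotient.
From mathcomp Require Import finmap monalg.
From mathcomp Require Import boolp classical_sets functions cardinality fsbigop.

Set Implicit Arguments.
Unset Strict Implicit.
Unset Printing Implicit Defensive.

Import GRing.Theory.
Local Open Scope ring_scope.
Local Open Scope quotient_scope.

HB.mixin Record Zmodule_isRng R of GRing.Zmodule R := {
  rngmul : R -> R -> R;
  rngmulA : associative rngmul;
  rngmulDl : left_distributive rngmul +%R;
  rngmulDr : right_distributive rngmul +%R
}.

#[short(type="rngType")]
HB.structure Definition Rng := {R of GRing.Zmodule R & Zmodule_isRng R}.

Notation "x ** y" := (rngmul x y)
  (at level 40, left associativity) : ring_scope.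

Section RngTheory.
Variable R : rngType.
Implicit Types x y z : R.

Lemma rngmul0l x : 0 ** x = 0.
Proof. by apply: (addrI (0 ** x)); rewrite -rngmulDl !addr0. Qed.

Lemma rngmul0r x : x ** 0 = 0.
Proof. by apply: (addrI (x ** 0)); rewrite -rngmulDr !addr0. Qed.

Lemma rngmulNl x y : (- x) ** y = - (x ** y).
Proof. by apply: (addrI (x ** y)); rewrite -rngmulDl !subrr rngmul0l. Qed.

Lemma rngmulNr x y : x ** (- y) = - (x ** y).
Proof. by apply: (addrI (x ** y)); rewrite -rngmulDr !subrr rngmul0r. Qed.

Lemma rngmulBl x y z : (x - y) ** z = x ** z - y ** z.
Proof. by rewrite rngmulDl rngmulNl. Qed.

Lemma rngmulBr x y z : x ** (y - z) = x ** y - x ** z.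
Proof. by rewrite rngmulDr rngmulNr. Qed.

Lemma rngmul_suml I (s : seq I) (F : I -> R) x :
  (\sum_(i <- s) F i) ** x = \sum_(i <- s) F i ** x.
Proof. by elim/big_ind2: _ => [|? ? ? ? <- <-|]; rewrite ?rngmul0l ?rngmulDl. Qed.

Lemma rngmul_sumr I (s : seq I) (F : I -> R) x :
  x ** (\sum_(i <- s) F i) = \sum_(i <- s) x ** F i.
Proof. by elim/big_ind2: _ => [|? ? ? ? <- <-|]; rewrite ?rngmul0r ?rngmulDr. Qed.

End RngTheory.

Definition exchange_ring (R : rngType) : Prop :=
  forall x : R, exists e r s : R,
    [/\ e ** e = e, e = x ** r & e = x + s - x ** s].

Record is_ideal (R : rngType) (I : R -> Prop) : Prop := IsIdeal {
  is_ideal0 : I 0;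
  is_idealB : forall x y, I x -> I y -> I (x - y);
  is_idealMl : forall a x, I x -> I (a ** x);
  is_idealMr : forall a x, I x -> I (x ** a)
}.

Definition ideal_generated (R : rngType) (S : R -> Prop) : R -> Prop :=
  fun x => forall I : R -> Prop, is_ideal I -> (forall y, S y -> I y) -> I x.

Lemma ideal_generatedP (R : rngType) (S : R -> Prop) :
  is_ideal (ideal_generated S).
Proof.
split=> [I idI _|x y Ix Iy I idI SI|a x Ix I idI SI|a x Ix I idI SI].
- exact: is_ideal0.
- by apply: is_idealB => //; [apply: Ix | apply: Iy].
- by apply: is_idealMl => //; apply: Ix.
- by apply: is_idealMr => //; apply: Ix.
Qed.

Section RngQuotient.
Variables (R : rngType) (S : R -> Prop).

Definition ideal_pred : {pred R} := fun x => `[< ideal_generated S x >].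

Lemma ideal_predP x : reflect (ideal_generated S x) (x \in ideal_pred).
Proof. exact: asboolP. Qed.

Fact ideal_pred_zmod_closed : zmod_closed ideal_pred.
Proof.
split=> [|x y /ideal_predP Ix /ideal_predP Iy]; apply/ideal_predP.
  exact: is_ideal0 (ideal_generatedP S).
exact: is_idealB (ideal_generatedP S) _ _ _ _.
Qed.

HB.instance Definition _ :=
  GRing.isZmodClosed.Build R ideal_pred ideal_pred_zmod_closed.

Definition rng_quot := {ideal_quot ideal_pred}.

HB.instance Definition _ := GRing.Zmodule.on rng_quot.

Definition rng_pi (x : R) : rng_quot := \pi_{ideal_quot ideal_pred} x.

Definition rng_quot_mul (x y : rng_quot) : rng_quot :=
  rng_pi (repr x ** repr y).

Lemma rng_pi_eq x y : rng_pi x = rng_pi y <-> ideal_generated S (x - y).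
Proof.
split=> [/eqP|/ideal_predP].
  by rewrite /rng_pi -Quotient.idealrBE => /ideal_predP.
by rewrite Quotient.idealrBE => /eqP.
Qed.

Lemma rng_piK x : rng_pi (repr x) = x. Proof. exact: reprK. Qed.

Lemma rng_piD x y : rng_pi (x + y) = rng_pi x + rng_pi y.
Proof. exact: Quotient.pi_add. Qed.

Lemma rng_piM x y : rng_quot_mul (rng_pi x) (rng_pi y) = rng_pi (x ** y).
Proof.
have [_ IB IMl IMr] := ideal_generatedP S.
have Irepr z : ideal_generated S (z - repr (rng_pi z)).
  by apply/rng_pi_eq; rewrite rng_piK.
apply/esym/rng_pi_eq.
rewrite -[x ** y](addrNK (x ** repr (rng_pi y))) -rngmulBr -addrA -rngmulBl.
have I0 := is_ideal0 (ideal_generatedP S).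
rewrite -[X in _ + X]opprK; apply: (IB); first exact: IMl.
by rewrite -sub0r; apply: IB => //; exact: IMr.
Qed.

Fact rng_quot_mulA : associative rng_quot_mul.
Proof.
move=> x y z; rewrite -[x]rng_piK -[y]rng_piK -[z]rng_piK.
by rewrite !rng_piM rngmulA.
Qed.

Fact rng_quot_mulDl : left_distributive rng_quot_mul +%R.
Proof.
move=> x y z; rewrite -[x]rng_piK -[y]rng_piK -[z]rng_piK.
by rewrite -rng_piD !rng_piM -rng_piD rngmulDl.
Qed.

Fact rng_quot_mulDr : right_distributive rng_quot_mul +%R.
Proof.
move=> x y z; rewrite -[x]rng_piK -[y]rng_piK -[z]rng_piK.
by rewrite -rng_piD !rng_piM -rng_piD rngmulDr.
Qed.

HB.instance Definition _ := Zmodule_isRng.Build rng_quot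
  rng_quot_mulA rng_quot_mulDl rng_quot_mulDr.

End RngQuotient.

(* The carriers are choiceTypes so that finitely supported functions on paths
   can be formed; this does not restrict the graph, as every type carries a
   choiceType structure ([gen_eqMixin], [gen_choiceMixin] of [boolp]). *)
Record digraph : Type := Digraph {
  vertex : choiceType;
  edge : choiceType;
  src : edge -> vertex;
  rng : edge -> vertex
}.

Definition sink (E : digraph) (v : vertex E) : Prop :=
  [set e : edge E | src e = v]%classic = set0.

Definition infinite_emitter (E : digraph) (v : vertex E) : Prop :=
  infinite_set [set e : edge E | src e = v]%classic.

Section Paths.
Variable E : digraph.

Fixpoint is_walk (v : vertex E) (s : seq (edge E)) : bool :=
  if s is e :: s' then (src e == v) && is_walk (rng e) s' else true.

Definition walk_end (v : vertex E) (s : seq (edge E)) : vertex E :=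
  last v (map (@rng E) s).

(* A path is recorded with its initial vertex, so that [(v, [::])] is the path
   of length zero at [v]. *)
Definition gpath : Type := {p : vertex E * seq (edge E) | is_walk p.1 p.2}.

HB.instance Definition _ := Choice.on gpath.

Definition path_src (p : gpath) : vertex E := (val p).1.
Definition path_edges (p : gpath) : seq (edge E) := (val p).2.
Definition path_rng (p : gpath) : vertex E :=
  walk_end (path_src p) (path_edges p).

Lemma is_walk_cat v s t :
  is_walk v (s ++ t) = is_walk v s && is_walk (walk_end v s) t.
Proof. by elim: s v => //= e s IHs v; rewrite IHs andbA. Qed.

Lemma walk_end_cat v s t : walk_end v (s ++ t) = walk_end (walk_end v s) t.
Proof. by rewrite /walk_end map_cat last_cat. Qed.

Definition vertex_path (v : vertex E) : gpath :=
  exist _ (v, [::]) (erefl true).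

Fact edge_path_subproof (e : edge E) : is_walk (src e) [:: e].
Proof. by rewrite /= eqxx. Qed.

Definition edge_path (e : edge E) : gpath :=
  exist _ (src e, [:: e]) (edge_path_subproof e).

(* Only used when [path_rng p = path_src q], and then the default value of
   [insubd] plays no role (see [val_path_cat]). *)
Definition path_cat (p q : gpath) : gpath :=
  insubd p (path_src p, path_edges p ++ path_edges q).

Lemma val_path_cat p q : path_rng p = path_src q ->
  val (path_cat p q) = (path_src p, path_edges p ++ path_edges q).
Proof.
move=> pq; rewrite val_insubd /= is_walk_cat (valP p) /=.
by rewrite -/(path_rng p) pq (valP q).
Qed.

Lemma path_src_cat p q : path_rng p = path_src q ->
  path_src (path_cat p q) = path_src p.
Proof. by move=> pq; rewrite /path_src val_path_cat. Qed.

Lemma path_rng_cat p q : path_rng p = path_src q ->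
  path_rng (path_cat p q) = path_rng q.
Proof.
move=> pq; rewrite /path_rng /path_src /path_edges val_path_cat //=.
by rewrite walk_end_cat -/(path_rng p) pq.
Qed.

Lemma path_catA p q r : path_rng p = path_src q -> path_rng q = path_src r ->
  path_cat p (path_cat q r) = path_cat (path_cat p q) r.
Proof.
move=> pq qr; apply: val_inj.
rewrite !val_path_cat ?path_src_cat ?path_rng_cat //.
by rewrite /path_edges !val_path_cat // catA.
Qed.

End Paths.

Definition closed_path (E : digraph) (p : gpath E) : Prop :=
  path_edges p <> [::] /\ path_rng p = path_src p.

Definition simple_closed_path (E : digraph) (p : gpath E) : Prop :=
  closed_path p /\
  (forall e, e \in behead (path_edges p) -> src e <> path_src p).

Definition conditionK (E : digraph) : Prop :=
  forall v : vertex E,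
    ~ exists! p : gpath E, simple_closed_path p /\ path_src p = v.

Definition path_algebra (K : fieldType) (E : digraph) : Type :=
  {malg K[gpath E]}.

HB.instance Definition _ (K : fieldType) (E : digraph) :=
  GRing.Lmodule.on (path_algebra K E).

(* Multiplication and basis vectors are locked, because unification attempts
   to compare elements of [{malg _[_]}] by unfolding are very slow. *)
HB.lock Definition path_elt (K : fieldType) (E : digraph) (p : gpath E) :
  path_algebra K E := << p >>.

Definition basis_mul (K : fieldType) (E : digraph) (p q : gpath E) :
    path_algebra K E :=
  if path_rng p == path_src q then path_elt K (path_cat p q) else 0.

HB.lock Definition path_mul (K : fieldType) (E : digraph)
    (f g : path_algebra K E) : path_algebra K E :=
  \sum_(p <- msupp f) \sum_(q <- msupp g) (f@_p * g@_q) *: basis_mul K p q.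

(* Stated over an abstract module, where rewriting is not slowed down by the
   conversion problems mentioned above. *)
Lemma bilinear_assoc (K : fieldType) (V : lmodType K) (T : Type) (b : T -> V)
    (mul : V -> V -> V) :
  (forall P : V -> Prop, P 0 -> (forall f g, P f -> P g -> P (f + g)) ->
    (forall a f, P f -> P (a *: f)) -> (forall p, P (b p)) -> forall f, P f) ->
  left_distributive mul +%R -> right_distributive mul +%R ->
  (forall a f g, mul (a *: f) g = a *: mul f g) ->
  (forall a f g, mul f (a *: g) = a *: mul f g) ->
  (forall f, mul 0 f = 0) -> (forall f, mul f 0 = 0) ->
  (forall p q r, mul (b p) (mul (b q) (b r)) = mul (mul (b p) (b q)) (b r)) ->
  associative mul.
Proof.
move=> ind mulDl mulDr mulZl mulZr mul0l mul0r mulb.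
move=> f g h.
elim/ind: f => [|f f' IH IH'|a f IH|p].
- by rewrite !mul0l.
- by rewrite !mulDl IH IH'.
- by rewrite !mulZl IH.
elim/ind: g => [|g g' IH IH'|a g IH|q].
- by rewrite !(mul0l, mul0r).
- by rewrite mulDl !mulDr mulDl IH IH'.
- by rewrite mulZl !mulZr mulZl IH.
elim/ind: h => [|h h' IH IH'|a h IH|r].
- by rewrite !mul0r.
- by rewrite !mulDr IH IH'.
- by rewrite !mulZr IH.
exact: mulb.
Qed.

Section PathAlgebra.
Variables (K : fieldType) (E : digraph).

Local Notation path_algebra := (path_algebra K E).
Local Notation basis_mul := (@basis_mul K E).
Local Notation path_mul := (@path_mul K E).
Local Notation "''b_' p" := (path_elt K p) (at level 8, p at level 2).

Lemma mcoeff_path_elt (p q : gpath E) : ('b_p)@_q = (p == q)%:R.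
Proof. by rewrite path_elt.unlock; exact: mcoeffU. Qed.

Lemma msupp_path_elt (p : gpath E) : msupp 'b_p = [fset p]%fset.
Proof. by rewrite path_elt.unlock msuppU oner_eq0. Qed.

Lemma path_mulEw (d1 d2 : {fset gpath E}) (f g : path_algebra) :
  (msupp f `<=` d1)%fset -> (msupp g `<=` d2)%fset ->
  path_mul f g =
  \sum_(p <- d1) \sum_(q <- d2) (f@_p * g@_q) *: basis_mul p q.
Proof.
move=> le1 le2; rewrite path_mul.unlock (big_fset_incl _ le1) /=.
  apply: eq_bigr => p _; apply: big_fset_incl => // q _ /mcoeff_outdom ->.
  by rewrite mulr0 scale0r.
move=> p _ /mcoeff_outdom fp.
by rewrite big1 // => q _; rewrite fp mul0r scale0r.
Qed.

Fact path_mulDl : left_distributive path_mul +%R.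
Proof.
move=> f g h; set d := (msupp f `|` msupp g)%fset.
rewrite !(@path_mulEw d (msupp h)) ?fsubsetUl ?fsubsetUr ?msuppD_le //.
rewrite -big_split; apply: eq_bigr => p _; rewrite -big_split.
by apply: eq_bigr => q _; rewrite mcoeffD mulrDl scalerDl.
Qed.

Fact path_mulDr : right_distributive path_mul +%R.
Proof.
move=> h f g; set d := (msupp f `|` msupp g)%fset.
rewrite !(@path_mulEw (msupp h) d) ?fsubsetUl ?fsubsetUr ?msuppD_le //.
rewrite -big_split; apply: eq_bigr => p _; rewrite -big_split.
by apply: eq_bigr => q _; rewrite mcoeffD mulrDr scalerDl.
Qed.

Lemma path_mulZl a f g : path_mul (a *: f) g = a *: path_mul f g.
Proof.
rewrite (@path_mulEw (msupp f) (msupp g)) ?msuppZ_le //.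
rewrite path_mul.unlock scaler_sumr; apply: eq_bigr => p _.
rewrite scaler_sumr.
by apply: eq_bigr => q _; rewrite mcoeffZ -mulrA scalerA.
Qed.

Lemma path_mulZr a f g : path_mul f (a *: g) = a *: path_mul f g.
Proof.
rewrite (@path_mulEw (msupp f) (msupp g)) ?msuppZ_le //.
rewrite path_mul.unlock scaler_sumr; apply: eq_bigr => p _.
rewrite scaler_sumr.
by apply: eq_bigr => q _; rewrite mcoeffZ mulrCA scalerA.
Qed.

Lemma path_mulUU (p q : gpath E) : path_mul 'b_p 'b_q = basis_mul p q.
Proof.
rewrite path_mul.unlock !msupp_path_elt !big_seq_fset1 !mcoeff_path_elt !eqxx.
by rewrite mulr1 scale1r.
Qed.

Lemma path_mul0l f : path_mul 0 f = 0.
Proof. by apply: (addrI (path_mul 0 f)); rewrite -path_mulDl !addr0. Qed.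

Lemma path_mul0r f : path_mul f 0 = 0.
Proof. by apply: (addrI (path_mul f 0)); rewrite -path_mulDr !addr0. Qed.

Lemma path_algebra_ind (P : path_algebra -> Prop) :
  P 0 -> (forall f g, P f -> P g -> P (f + g)) ->
  (forall a f, P f -> P (a *: f)) -> (forall p, P 'b_p) -> forall f, P f.
Proof.
move=> P0 PD PZ Pp f; rewrite [f]monalgE; apply: big_ind => // p _.
rewrite (_ : << _ *g p >> = f@_p *: 'b_p); first exact: PZ.
apply/malgP => q; rewrite [RHS]mcoeffZ mcoeff_path_elt [LHS]mcoeffU.
by rewrite mulr_natr.
Qed.

Lemma basis_mulA (p q r : gpath E) :
  path_mul 'b_p (basis_mul q r) = path_mul (basis_mul p q) 'b_r.
Proof.
rewrite {2}/basis_mul; case: eqP => [pq|pq]; last first.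
  rewrite path_mul0l /basis_mul; case: eqP => [qr|_]; last exact: path_mul0r.
  by rewrite path_mulUU /basis_mul path_src_cat //; case: eqP pq.
rewrite path_mulUU /basis_mul path_rng_cat //.
case: eqP => [qr|_]; last exact: path_mul0r.
rewrite path_mulUU /basis_mul path_src_cat // path_catA //.
by case: eqP pq.
Qed.

Fact path_mulA : associative path_mul.
Proof.
apply: (bilinear_assoc path_algebra_ind path_mulDl path_mulDr path_mulZl
  path_mulZr path_mul0l path_mul0r) => p q r.
by rewrite !path_mulUU basis_mulA.
Qed.

HB.instance Definition _ :=
  Zmodule_isRng.Build path_algebra path_mulA path_mulDl path_mulDr.

End PathAlgebra.

(* [inl e] is the edge [e], [inr e] its ghost [e^*]. *)
Definition double (E : digraph) : digraph :=
  @Digraph (vertex E) (edge E + edge E)%type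
    (fun x => match x with inl e => src e | inr e => rng e end)
    (fun x => match x with inl e => rng e | inr e => src e end).

Section Leavitt.
Variables (K : fieldType) (E : digraph).

Local Notation KE := (path_algebra K (double E)).

Definition leavitt_vertex (v : vertex E) : KE :=
  path_elt K (vertex_path (E := double E) v).
Definition leavitt_edge (e : edge E) : KE :=
  path_elt K (edge_path (E := double E) (inl e)).
Definition leavitt_ghost (e : edge E) : KE :=
  path_elt K (edge_path (E := double E) (inr e)).

Inductive leavitt_relator : KE -> Prop :=
| Relator_CK1 e :
    leavitt_relator (leavitt_ghost e ** leavitt_edge e - leavitt_vertex (rng e))
| Relator_CK1_neq e f : e <> f ->
    leavitt_relator (leavitt_ghost e ** leavitt_edge f)
| Relator_CK2 v : ~ sink v -> ~ infinite_emitter v ->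
    leavitt_relator
      (leavitt_vertex v -
       \sum_(e \in [set e : edge E | src e = v]%classic)
         leavitt_edge e ** leavitt_ghost e).

(* An ideal of the ring [KE] is automatically a K-subspace, since every element
   of [KE] is fixed by left multiplication by a finite sum of vertices. *)
Definition leavitt_path_algebra : rngType := rng_quot leavitt_relator.

End Leavitt.

(* Main.v *)
Require Import Defs.
From mathcomp Require Import all_boot all_algebra.
From Stdlib Require Ncring Ncring_tac.
From HB Require Import structures.
From mathcomp Require Import finmap monalg zify ring.
From mathcomp Require Import boolp classical_sets cardinality fsbigop.

(* If [v] is the base of a single simple closed path [c], then [L_K(E)] acts on
   the [K(x)]-valued functions on the set of paths ending at [v] and avoiding it
   before, [c] acting as [x] times the projection to the value at the trivial
   path, and the [K[x, 1/x]]-valued functions are preserved.  Looking at that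
   value, the exchange condition for [c + c^2] would make [x + x^2] or
   [1 - x - x^2] a unit of [K[x, 1/x]].
   Conversely, an element of [L_K(E)] only involves finitely many edges, and
   under Condition (K) they lie in a finite subgraph in which every cycle meets
   a second one.  The span of [1] and the [p q^*] over this subgraph is treated
   by induction on the set [U] of admissible range vertices, removing a terminal
   strongly connected component [C] of [U].  Paths ending in [C] span an ideal
   with a complementary subalgebra, since (CK2) is never imposed; hence
   idempotents lift, and one is left with [a = e + j], [e] idempotent and [j] in
   the ideal.  Linear algebra yields an idempotent [k] of the ideal with
   [k j = j] and [k e k = e k], so that only the corner at [k] matters.  There
   [a - a^2] is either von Neumann regular, and [a] is corrected directly, or a
   vertex of [C] can be split off from it, and two incomparable closed paths
   through that vertex leave enough room to absorb all of the corner. *)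

Set Implicit Arguments.
Unset Strict Implicit.
Unset Printing Implicit Defensive.

Import GRing.Theory.
Local Open Scope ring_scope.

(** The exchange property passes from an ideal and its quotient to the ring only if idempotents
    lift. Without (CK2), the quotient by the ideal of a terminal component is realised by a
    subalgebra, so an idempotent of the quotient is already an idempotent of the ring. The price is
    that (CK2) may fail at each vertex of [C] by an idempotent [out v]. The span [J] of the elements
    p [out v] q^* consists of combinations of matrix units and is therefore von Neumann regular,
    while every element of the ideal outside [J] can be multiplied to a vertex of [C]. This is the
    dichotomy applied to [a - a * a]. In the other direction the loop [c] itself is of no use,
    because it acts by [x], a unit of K[x, 1/x]. An element is needed that is a non-unit together
    with its complement, over every field, the field with two elements included. *)

#[local] Instance ncring_ops (R : pzRingType) :
  @Ncring.Ring_ops R 0 1 +%R *%R (fun x y => x - y) -%R eq := {}.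

#[local] Instance ncring (R : pzRingType) :
  @Ncring.Ring R 0 1 +%R *%R (fun x y => x - y) -%R eq (ncring_ops R).
Proof.
split; try exact: RelationClasses.eq_equivalence.
- by move=> x y -> ? ? ->.
- by move=> x y -> ? ? ->.
- by move=> x y -> ? ? ->.
- by move=> x y ->.
- exact: add0r.
- exact: addrC.
- exact: addrA.
- exact: mul1r.
- exact: mulr1.
- exact: mulrA.
- exact: mulrDl.
- by move=> x y z; apply: mulrDr.
- by [].
- exact: subrr.
Qed.

(** The tactic knows the ring axioms only. Relations such as [k * k = k] enter through a
    [transitivity] to an expression in which they can be rewritten. *)
Ltac non_commutative_ring := Ncring_tac.non_commutative_ring.

(** * Suitable elements *)

Section SubringPred.
Variable R : pzRingType.

(** A predicate rather than a ring type: the induction runs through a chain of subalgebras of one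
    ring and must record in which of them the witnesses of [suitable] lie. *)
Definition subring_pred (B : R -> Prop) : Prop :=
  [/\ B 1, forall x y, B x -> B y -> B (x - y)
     & forall x y, B x -> B y -> B (x * y)].

Variables (B : R -> Prop) (HB : subring_pred B).

Lemma subring1 : B 1. Proof. by case: HB. Qed.

Lemma subringB x y : B x -> B y -> B (x - y).
Proof. by case: HB => _ + _; apply. Qed.

Lemma subringM x y : B x -> B y -> B (x * y).
Proof. by case: HB => _ _; apply. Qed.

Lemma subringN x : B x -> B (- x).
Proof.
move=> Bx; have := subringB (subringB subring1 subring1) Bx.
by rewrite subrr sub0r.
Qed.

Lemma subringD x y : B x -> B y -> B (x + y).
Proof. by move=> Bx By; rewrite -[y]opprK; apply: subringB => //; apply: subringN. Qed.

End SubringPred.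

Ltac in_subring := repeat
  (eassumption || apply: subring1 || apply: subringB || apply: subringD
   || apply: subringN || apply: subringM).

Section Suitable.
Variable R : pzRingType.

(* The exchange condition of a unital ring, with [t = 1 - s]. *)
Definition suitable (B : R -> Prop) (a : R) : Prop :=
  exists e r t, [/\ B r, B t, e * e = e, e = a * r & 1 - e = (1 - a) * t].

Lemma suitable_trans (B : R -> Prop) a u r t : subring_pred B -> B r -> B t ->
  u = a * r -> 1 - u = (1 - a) * t -> suitable B u -> suitable B a.
Proof.
move=> HB Br Bt ur ut [e [r' [t' [Br' Bt' ee er et]]]].
exists e, (r * r'), (t * t').
by split=> //; rewrite ?mulrA -?ur -?ut //; in_subring.
Qed.

(** The element f = d z is idempotent with (1 - f) d = 0. Put e = f + (1 - f) a, so that 1 - e = (1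
    - f) (1 - a); since [a] commutes with [d], the product e (1 - e) vanishes. *)
Lemma suitable_regular (B : R -> Prop) a z : subring_pred B -> B a -> B z ->
  (a - a * a) * z * (a - a * a) = a - a * a -> suitable B a.
Proof.
move=> HB Ba Bz dzd; set d := a - a * a in dzd.
have X0 : d * z * d - d = 0 by rewrite dzd subrr.
exists (d * z + (1 - d * z) * a), ((1 - a) * z + 1 - (1 - a) * z * a),
  (1 - a * z * (1 - a)).
split; [in_subring | in_subring | | rewrite /d; non_commutative_ring
       | rewrite /d; non_commutative_ring].
apply/eqP; rewrite -subr_eq0; apply/eqP.
transitivity ((d * z * d - d) * (1 + z - z * a - a * z + a * z * a)).
  rewrite /d; non_commutative_ring.
by rewrite X0 mul0r.
Qed.

(** With respect to [k] and [1 - k], [a] is block triangular with an idempotent block [n], whose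
    complement is [n']. As [a * n] and [(1 - a) * n'] agree with [n] and [n'] modulo k R, the ring
    is the direct sum of k R, a n R and (1 - a) n' R, and [l] is the projection to the first
    summand. The idempotent sought acts as [e1] on k R, as the identity on the second summand and as
    0 on the third. *)
Lemma suitable_triangular (B : R -> Prop) a k : subring_pred B -> B a -> B k ->
  k * k = k -> k * a * k = a * k ->
  (1 - k) * a * ((1 - k) * a) = (1 - k) * a ->
  suitable B (k * a * k) -> suitable B a.
Proof.
move=> HB Ba Bk kk kak nn [e1 [r [t [Br Bt ee er et]]]].
set n := (1 - k) * a in nn; pose n' := (1 - k) * (1 - a).
pose l := k * (1 - a * n - (1 - a) * n').
have kn : k * n = 0 by rewrite /n mulrA mulrBr kk mulr1 subrr mul0r.
have nk : n * k = 0.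
  by rewrite /n -mulrA -kak !mulrA mulrBl mul1r kk subrr !mul0r.
have n'E : n' = 1 - k - n by rewrite /n' /n mulrBr mulr1.
have an : (1 - k) * a * n = n by rewrite -[RHS]nn.
have bn' : (1 - k) * (1 - a) * n' = n'.
  transitivity (n' + (k * n + n * k + (n * n - n) + (k * k - k))); last first.
    by rewrite kn nk nn kk !subrr !addr0.
  rewrite -/n' n'E; non_commutative_ring.
have aE : a * n = n + k * a * n by rewrite -{2}an; non_commutative_ring.
have bE : (1 - a) * n' = n' + k * (1 - a) * n'.
  by rewrite -{2}bn'; non_commutative_ring.
have ke : k * e1 = e1 by rewrite er !mulrA kk.
have lE : k * l = l by rewrite /l mulrA kk.
have lk : l * k = k.
  have n'k : n' * k = 0 by rewrite n'E !mulrBl nk mul1r kk subrr subr0.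
  transitivity (k * k - k * a * (n * k) - k * (1 - a) * (n' * k)).
    rewrite /l; non_commutative_ring.
  by rewrite kk nk n'k !mulr0 !subr0.
have ln : l * n = - (k * a * n).
  have n'n : n' * n = 0 by rewrite n'E !mulrBl nn kn mul1r !subr0 subrr.
  transitivity (k * n - k * a * (n * n) - k * (1 - a) * (n' * n)).
    rewrite /l; non_commutative_ring.
  by rewrite kn nn n'n mulr0 subr0 sub0r.
have lan : l * (a * n) = 0.
  by rewrite aE mulrDr ln !mulrA lk addNr.
have le : l * e1 = e1 by rewrite -ke mulrA lk.
have ne : n * e1 = 0 by rewrite -ke mulrA nk mul0r.
have nan : n * (a * n) = n by rewrite aE mulrDr nn !mulrA nk !mul0r addr0.
exists (e1 * k * l + a * n), (k * r * k * l + n), (k * t * k * l + n').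
split.
- rewrite /l /n' /n; in_subring.
- rewrite /l /n' /n; in_subring.
- transitivity (e1 * k * (l * e1) * k * l + e1 * k * (l * (a * n))
                + a * (n * e1) * k * l + a * (n * (a * n))).
    non_commutative_ring.
  by rewrite le lan ne nan !mulr0 !mul0r !addr0 -(mulrA e1 k) ke ee.
- by rewrite mulrDr er !mulrA kak.
- have E2 : (1 - e1) * k = (1 - a) * k * t * k.
    have -> : (1 - e1) * k = k * ((1 - e1) * k).
      by rewrite mulrA mulrBr mulr1 ke !mulrBl mul1r kk.
    rewrite et !mulrA; congr (_ * _ * _).
    by rewrite mulrBr mulr1 !mulrA kk kak mulrBl mul1r.
  transitivity ((1 - e1) * k * l + (1 - a) * n'); last first.
    by rewrite E2; non_commutative_ring.
  rewrite bE mulrBl mul1r mulrBl lE aE /l n'E; non_commutative_ring.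
Qed.

(* With [g] below [a] and [k - a], the corner [m = k - g] is split into the
   images of the two maps [alpha = m a m + sg] and [m - alpha]: since
   [tau * alpha = m] these are complemented direct summands, and they lie in
   [a R] and [(k - a) R] because [g] does. *)
Lemma suitable_absorb (B : R -> Prop) a k g z sg tau : subring_pred B ->
  B a -> B k -> B z -> B sg -> B tau ->
  k * k = k -> k * a = a -> a * k = a ->
  g = (a - a * a) * z -> g * g = g -> g * k = g ->
  g * sg = sg -> sg * (k - g) = sg -> tau * g = tau -> (k - g) * tau = tau ->
  tau * sg = k - g -> suitable B a.
Proof.
move=> HB Ba Bk Bz Bsg Btau kk ka ak gE gg gk gs sm tg mt ts.
have kg : k * g = g by rewrite gE mulrA mulrBr mulrA !ka.
set m := k - g in sm mt ts.
have Bg : B g by rewrite gE; in_subring.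
have Bm : B m by rewrite /m; in_subring.
have mm : m * m = m by rewrite /m mulrBl !mulrBr kk kg gk gg subrr subr0.
have gm : g * m = 0 by rewrite /m mulrBr gk gg subrr.
have mg : m * g = 0 by rewrite /m mulrBl kg gg subrr.
have ms : m * sg = 0 by rewrite -gs mulrA mg mul0r.
have tm : tau * m = 0 by rewrite -tg -mulrA gm mulr0.
have km : k * m = m by rewrite /m mulrBr kk kg.
have mk : m * k = m by rewrite /m mulrBl kk gk.
have ks : k * sg = sg by rewrite -gs mulrA kg.
have tk : tau * k = tau by rewrite -tg -mulrA gk.
(* Here [be] is m - alpha. The element [ga] is a left inverse of it that also annihilates alpha, so
   [k - be * ga] is the projection of k R along the image of [be]. *)
pose be := m * (k - a) * m - sg; pose ga := m - m * a * tau.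
have gabe : ga * be = m.
  transitivity (m * m * (k - a) * m - m * sg - m * a * (tau * m) * (k - a) * m
                + m * a * (tau * sg)); first by rewrite /ga /be; non_commutative_ring.
  rewrite ms tm ts mm mulr0 !mul0r !subr0 mulrBr mk mulrBl mm.
  by rewrite subrK.
have bem : be * m = be by rewrite /be mulrBl -mulrA mm sm.
have kbe : k * be = be by rewrite /be (mulrBr k) ks !mulrA km.
have gak : ga * k = ga by rewrite /ga mulrBl -(mulrA _ tau) tk mk.
exists (k - be * ga),
  ((m + (1 - a) * z * (sg - a * m)) * (tau + ga) + (1 - a) * z * (1 - sg * tau)),
  (1 - k + (m - a * z * ((k - a) * m + sg)) * ga); split.
- rewrite /ga; in_subring.
- rewrite /ga; in_subring.
- transitivity (k * k - k * be * ga - be * (ga * k) + be * (ga * be) * ga).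
    non_commutative_ring.
  by rewrite kk kbe gak gabe bem subrK.
- transitivity ((m * a * m + sg) * (tau + ga) + (g - sg * tau)).
    have mga : m * ga = ga by rewrite /ga mulrBr mm !mulrA mm.
    have E1 : be * ga = ga - (m * a * m + sg) * ga.
      transitivity (m * k * (m * ga) - (m * a * m + sg) * ga).
        rewrite /be; non_commutative_ring.
      by rewrite mk !mga.
    have E2 : m * a * tau = m * a * m * tau by rewrite -[in RHS]mulrA mt.
    transitivity (k - m + m * a * tau + (m * a * m + sg) * ga).
      rewrite E1 {1}/ga; non_commutative_ring.
    rewrite E2 /m; non_commutative_ring.
  transitivity (a * m * (tau + ga) - g * (a * m) * (tau + ga)
      + g * sg * (tau + ga) + g - g * sg * tau).
    have -> : m * a * m = a * m - g * (a * m).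
      by rewrite {1}/m mulrBl ka mulrBl -mulrA.
    rewrite gs; non_commutative_ring.
  rewrite gE; non_commutative_ring.
- have beE : be = (1 - a) * m - g * ((k - a) * m + sg).
    transitivity ((1 - a) * (k * m) - g * ((k - a) * m) - g * sg).
      rewrite gs /be {1}/m.
      transitivity (k * (k * m) - k * a * m - g * ((k - a) * m) - sg).
        non_commutative_ring.
      rewrite ka !km; non_commutative_ring.
    rewrite km; non_commutative_ring.
  transitivity (1 - k + be * ga); first by non_commutative_ring.
  rewrite beE gE.
  transitivity ((1 - k) - (a - a * k) +
    ((1 - a) * m - (a - a * a) * z * ((k - a) * m + sg)) * ga).
    by rewrite ak subrr subr0.
  non_commutative_ring.
Qed.
End Suitable.

(** * Linear spans and matrix units *)

Section Span.
Variables (K : fieldType) (T : algType K).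
Implicit Types (X Y Z : T -> Prop) (x y : T).

Inductive kspan X : T -> Prop :=
| kspan0 : kspan X 0
| kspanD x y : kspan X x -> kspan X y -> kspan X (x + y)
| kspanZ a x : kspan X x -> kspan X (a *: x)
| kspan_gen x : X x -> kspan X x.

Lemma kspanN X x : kspan X x -> kspan X (- x).
Proof. by rewrite -scaleN1r; apply: kspanZ. Qed.

Lemma kspanB X x y : kspan X x -> kspan X y -> kspan X (x - y).
Proof. by move=> Xx Xy; apply: kspanD => //; apply: kspanN. Qed.

Lemma kspan_sum X (I : Type) (r : seq I) (p : pred I) (F : I -> T) :
  (forall i, p i -> kspan X (F i)) -> kspan X (\sum_(i <- r | p i) F i).
Proof.
by move=> XF; apply: big_ind => // [|x y]; [apply: kspan0 | apply: kspanD].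
Qed.

Lemma kspan_sub X Y : (forall x, X x -> kspan Y x) -> forall x, kspan X x -> kspan Y x.
Proof.
move=> XY x; elim=> [|{}x y _ Yx _ Yy|a {}x _ Yx|{}x /XY //].
- exact: kspan0.
- exact: kspanD.
- exact: kspanZ.
Qed.

Lemma kspan_mul X Y Z : (forall x y, X x -> Y y -> kspan Z (x * y)) ->
  forall x y, kspan X x -> kspan Y y -> kspan Z (x * y).
Proof.
move=> XYZ x y Xx; elim: Xx y => [|{}x x' _ IH _ IH'|a {}x _ IH|{}x Xx] y Yy.
- by rewrite mul0r; apply: kspan0.
- by rewrite mulrDl; apply: kspanD; [apply: IH | apply: IH'].
- by rewrite -scalerAl; apply: kspanZ; apply: IH.
elim: Yy => [|{}y y' _ IH _ IH'|a {}y _ IH|{}y Yy].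
- by rewrite mulr0; apply: kspan0.
- by rewrite mulrDr; apply: kspanD.
- by rewrite -scalerAr; apply: kspanZ.
- exact: XYZ.
Qed.

End Span.

Section MatrixUnits.
Variables (K : fieldType) (T : algType K) (L : eqType).

Section Ordinal.
Variables (n : nat) (u w : 'I_n -> T) (q : L -> T) (lab : 'I_n -> L).
Hypothesis wu : forall i j, w i * u j = if i == j then q (lab i) else 0.
Hypothesis uq : forall i, u i * q (lab i) = u i.

(** The products [u i * w j] multiply like matrix units except that [q (lab i)] stands in the
    middle. It can be absorbed by [u] only between equal labels, whence the restriction to block
    diagonal matrices. *)
Definition mxelt (M : 'M[K]_n) : T := \sum_i \sum_j M i j *: (u i * w j).
Definition lab_diag (M : 'M[K]_n) := forall i j, lab i != lab j -> M i j = 0.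

Lemma mxelt_mul M N : lab_diag M -> mxelt M * mxelt N = mxelt (M *m N).
Proof.
move=> dM; rewrite /mxelt mulr_suml; apply: eq_bigr => i _.
transitivity (\sum_j \sum_k (M i j * N j k) *: (u i * w k)).
  rewrite mulr_suml; apply: eq_bigr => j _.
  rewrite mulr_sumr (bigD1 j) //= [X in _ + X]big1 ?addr0 => [|k kj]; last first.
    rewrite mulr_sumr big1 // => m _.
    rewrite -scalerAl -scalerAr mulrA -(mulrA (u i)) wu eq_sym (negbTE kj).
    by rewrite mulr0 mul0r !scaler0.
  rewrite mulr_sumr; apply: eq_bigr => k _.
  rewrite -scalerAl -scalerAr mulrA -(mulrA (u i)) wu eqxx scalerA.
  by have [<-|/dM ->] := eqVneq (lab i) (lab j); rewrite ?uq // !mul0r !scale0r.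
rewrite exchange_big; apply: eq_bigr => k _.
by rewrite mxE scaler_suml.
Qed.

Lemma mxelt_regular M : lab_diag M ->
  exists2 N, lab_diag N & mxelt M * mxelt N * mxelt M = mxelt M.
Proof.
move=> dM.
(* A pseudo-inverse of [M] need not be block diagonal. Its block diagonal part serves as well, since
   the other blocks do not contribute to the diagonal blocks of M N M. *)
pose N : 'M_n := \matrix_(i, j) if lab i == lab j then pinvmx M i j else 0.
have dN : lab_diag N by move=> i j /negbTE ij; rewrite mxE ij.
have dMN : lab_diag (M *m N).
  move=> i j ij; rewrite mxE big1 // => k _.
  have [ik|/dM ->] := eqVneq (lab i) (lab k); last by rewrite mul0r.
  by rewrite dN ?mulr0 // -ik.
exists N => //; rewrite !mxelt_mul //; congr mxelt.
apply/matrixP => i j; have [ij|ij] := eqVneq (lab i) (lab j); last first.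
  rewrite [RHS]dM // mxE big1 // => k _.
  have [kj|/dM ->] := eqVneq (lab k) (lab j); last by rewrite mulr0.
  by rewrite dMN ?mul0r // kj.
rewrite -[in RHS](mulmxKpV (submx_refl M)) !mxE; apply: eq_bigr => k _.
have [kj|/dM ->] := eqVneq (lab k) (lab j); last by rewrite !mulr0.
congr (_ * _); rewrite !mxE; apply: eq_bigr => l _.
have [il|/dM ->] := eqVneq (lab i) (lab l); last by rewrite !mul0r.
by rewrite mxE -il ij kj eqxx.
Qed.

End Ordinal.

Variables (I : choiceType) (u w : I -> T) (q : L -> T) (lab : I -> L).
Hypothesis wu : forall i j, w i * u j = if i == j then q (lab i) else 0.
Hypothesis uq : forall i, u i * q (lab i) = u i.

Inductive unit_gen : T -> Prop :=
  UnitGen i j : lab i = lab j -> unit_gen (u i * w j).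

Lemma kspan_unit_fset x : kspan unit_gen x ->
  exists A : {fset I}, exists M : I -> I -> K,
    [/\ forall i j, lab i != lab j -> M i j = 0,
        forall i j, (i \notin A) || (j \notin A) -> M i j = 0
      & forall B : {fset I}, A `<=` B ->
        x = \sum_(i <- B) \sum_(j <- B) M i j *: (u i * w j)]%fset.
Proof.
elim=> [|{}x y _ [A [M [dM sM xE]]] _ [B [N [dN sN yE]]]
        |a {}x _ [A [M [dM sM xE]]]|_ [i j ij]].
- exists fset0, (fun _ _ => 0); split=> // B _.
  by rewrite big1 // => i _; rewrite big1 // => j _; rewrite scale0r.
- exists (A `|` B)%fset, (fun i j => M i j + N i j); split.
  + by move=> i j ij; rewrite dM // dN // addr0.
  + move=> i j; rewrite !inE !negb_or => ij.
    rewrite sM ?sN ?addr0 //.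
      by case/orP: ij => /andP[_ ->]; rewrite ?orbT.
    by case/orP: ij => /andP[-> _]; rewrite ?orbT.
  + move=> C ABC; rewrite (xE C) ?(yE C); last 2 first.
    * exact: fsubset_trans (fsubsetUr A B) ABC.
    * exact: fsubset_trans (fsubsetUl A B) ABC.
    rewrite -big_split; apply: eq_bigr => i _.
    by rewrite -big_split; apply: eq_bigr => j _; rewrite scalerDl.
- exists A, (fun i j => a * M i j); split.
  + by move=> i j ij; rewrite dM // mulr0.
  + by move=> i j ij; rewrite sM // mulr0.
  + move=> B AB; rewrite (xE B) // scaler_sumr; apply: eq_bigr => i _.
    by rewrite scaler_sumr; apply: eq_bigr => j _; rewrite scalerA.
exists [fset i; j]%fset, (fun k l => ((k == i) && (l == j))%:R); split.
- move=> k l; have [->|] := eqVneq k i; last by [].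
  by have [->|] := eqVneq l j; rewrite // ij eqxx.
- move=> k l; have [->|] := eqVneq k i; last by [].
  by have [->|] := eqVneq l j; rewrite // !inE !eqxx orbT.
move=> B /fsubsetP AB.
have Bi : i \in B by apply: AB; rewrite !inE eqxx.
have Bj : j \in B by apply: AB; rewrite !inE eqxx orbT.
rewrite (big_fsetD1 i) //= (big_fsetD1 j) //= !eqxx scale1r.
rewrite !big1_fset ?addr0 // => k; rewrite !inE => /andP[/negbTE ki _] _.
  by rewrite big1_fset // => l _ _; rewrite ki scale0r.
by rewrite ki andbF scale0r.
Qed.

Lemma kspan_unit_regular x : kspan unit_gen x ->
  exists2 z, kspan unit_gen z & x * z * x = x.
Proof.
case/kspan_unit_fset=> A [M [dM _ /(_ A (fsubset_refl A)) ->]].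
pose ev (i : 'I_#|{: A}|) : I := val (enum_val i).
have wu' i j : w (ev i) * u (ev j) = if i == j then q (lab (ev i)) else 0.
  by rewrite wu /ev (inj_eq val_inj) (inj_eq enum_val_inj).
have E : \sum_(i <- A) \sum_(j <- A) M i j *: (u i * w j)
       = mxelt (u \o ev) (w \o ev) (\matrix_(i, j) M (ev i) (ev j)).
  rewrite big_seq_fsetE big_enum_val; apply: eq_bigr => i _ /=.
  rewrite big_seq_fsetE big_enum_val; apply: eq_bigr => j _ /=.
  by rewrite mxE.
have [] := @mxelt_regular _ _ _ q (lab \o ev) wu' (fun i => uq (ev i))
  (\matrix_(i, j) M (ev i) (ev j)).
  by move=> i j ij; rewrite mxE dM.
rewrite E => N dN NE; exists (mxelt (u \o ev) (w \o ev) N) => //.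
rewrite /mxelt; apply: kspan_sum => i _; apply: kspan_sum => j _.
have [ij|/dN ->] := eqVneq (lab (ev i)) (lab (ev j)); last first.
  by rewrite scale0r; apply: kspan0.
by apply: kspanZ; apply: kspan_gen.
Qed.

End MatrixUnits.

(** * Spans of paths over a finite graph *)

(* (CK2) is left out on purpose. *)
Record cohn_family (E : digraph) (K : fieldType) (T : algType K)
  (P : vertex E -> T) (S S' : edge E -> T) : Prop := CohnFamily {
  cohn_PP : forall v w, P v * P w = if v == w then P v else 0;
  cohn_PS : forall e, P (src e) * S e = S e;
  cohn_SP : forall e, S e * P (rng e) = S e;
  cohn_S'P : forall e, S' e * P (src e) = S' e;
  cohn_PS' : forall e, P (rng e) * S' e = S' e;
  cohn_S'S : forall e f, S' e * S f = if e == f then P (rng e) else 0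
}.

Section Cohn.
Variables (E : digraph) (K : fieldType) (T : algType K).
Variables (P : vertex E -> T) (S S' : edge E -> T).
Hypothesis coh : cohn_family P S S'.
Implicit Types (v w : vertex E) (s t r : seq (edge E)).

(* The path from [v] with edges [s] and its ghost, provided [s] is a walk from
   [v]; note that [v] is only read when [s] is empty. *)
Fixpoint sp v s : T := if s is e :: s' then S e * sp (rng e) s' else P v.
Fixpoint sp' v s : T := if s is e :: s' then sp' (rng e) s' * S' e else P v.

Lemma PP v : P v * P v = P v. Proof. by rewrite (cohn_PP coh) eqxx. Qed.

Lemma PPn v w : v != w -> P v * P w = 0.
Proof. by rewrite (cohn_PP coh) => /negbTE ->. Qed.

Lemma P_sp v s : is_walk v s -> P v * sp v s = sp v s.
Proof.
case: s => [|e s] /=; first by rewrite PP.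
by case/andP=> /eqP <- _; rewrite mulrA (cohn_PS coh).
Qed.

Lemma sp'_P v s : is_walk v s -> sp' v s * P v = sp' v s.
Proof.
case: s => [|e s] /=; first by rewrite PP.
by case/andP=> /eqP <- _; rewrite -mulrA (cohn_S'P coh).
Qed.

Lemma sp_P v s : sp v s * P (walk_end v s) = sp v s.
Proof. by elim: s v => [|e s IH] v /=; rewrite ?PP // -mulrA IH. Qed.

Lemma P_sp' v s : P (walk_end v s) * sp' v s = sp' v s.
Proof. by elim: s v => [|e s IH] v /=; rewrite ?PP // mulrA IH. Qed.

Lemma sp_cat v s t : is_walk (walk_end v s) t ->
  sp v (s ++ t) = sp v s * sp (walk_end v s) t.
Proof.
elim: s v => [|e s IH] v /= Wt; first by rewrite P_sp.
by rewrite IH // mulrA.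
Qed.

Lemma sp'_cat v s t : is_walk (walk_end v s) t ->
  sp' v (s ++ t) = sp' (walk_end v s) t * sp' v s.
Proof.
elim: s v => [|e s IH] v /= Wt; first by rewrite sp'_P.
by rewrite IH // mulrA.
Qed.

Lemma sp'_sp v s : is_walk v s -> sp' v s * sp v s = P (walk_end v s).
Proof.
elim: s v => [|e s IH] v /=; first by rewrite PP.
case/andP=> _ Ws; rewrite mulrA -(mulrA _ (S' e)) (cohn_S'S coh) eqxx.
by rewrite sp'_P // IH.
Qed.

Lemma sp'_sp_prefix v s r : is_walk v (s ++ r) ->
  sp' v s * sp v (s ++ r) = sp (walk_end v s) r.
Proof.
rewrite is_walk_cat => /andP[Ws Wr].
by rewrite sp_cat // mulrA sp'_sp // P_sp.
Qed.

Lemma sp'_sp_suffix v s r : is_walk v (s ++ r) ->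
  sp' v (s ++ r) * sp v s = sp' (walk_end v s) r.
Proof.
rewrite is_walk_cat => /andP[Ws Wr].
by rewrite sp'_cat // -mulrA sp'_sp // sp'_P.
Qed.

(** Ghost and real edges cancel one by one until they differ or one of the walks is exhausted. *)
Lemma sp'_sp_case v s w t : is_walk v s -> is_walk w t ->
  [\/ v = w /\ exists r, t = s ++ r, v = w /\ exists r, s = t ++ r
    | sp' v s * sp w t = 0].
Proof.
have [<-{w} Ws Wt|vw Ws Wt] := eqVneq v w; last first.
  by apply: Or33; rewrite -sp'_P // -(P_sp Wt) mulrA -(mulrA _ (P v)) PPn // mulr0 mul0r.
elim: s t v Ws Wt => [|e s IH] t v Ws Wt; first by apply: Or31; split=> //; exists t.
case: t Wt => [|f t] Wt; first by apply: Or32; split=> //; exists (e :: s).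
have [ef|ef] := eqVneq e f; last first.
  apply: Or33; rewrite /= mulrA -(mulrA _ (S' e)) (cohn_S'S coh) (negbTE ef).
  by rewrite mulr0 mul0r.
subst f; move: Ws Wt => /= /andP[_ Ws] /andP[_ Wt].
case: (IH _ _ Ws Wt) => [[_ [r ->]]|[_ [r ->]]|st].
- by apply: Or31; split=> //; exists r.
- by apply: Or32; split=> //; exists r.
apply: Or33.
by rewrite mulrA -(mulrA _ (S' e)) (cohn_S'S coh) eqxx sp'_P.
Qed.

Variable De : {fset edge E}.

Definition dwalk v s := is_walk v s && all (fun e => e \in De) s.

Definition reach v w : Prop := exists2 s, dwalk v s & walk_end v s = w.

Lemma dwalk_cat v s t :
  dwalk v (s ++ t) = dwalk v s && dwalk (walk_end v s) t.
Proof. by rewrite /dwalk is_walk_cat all_cat andbACA. Qed.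

Lemma dwalkW v s : dwalk v s -> is_walk v s. Proof. by case/andP. Qed.

Lemma reach_refl v : reach v v. Proof. by exists [::]. Qed.

Lemma reach_trans u v w : reach u v -> reach v w -> reach u w.
Proof.
move=> [s Ws sE] [t Wt <-]; exists (s ++ t); last by rewrite walk_end_cat sE.
by rewrite dwalk_cat Ws sE.
Qed.

Lemma reach_edge e : e \in De -> reach (src e) (rng e).
Proof. by move=> De_e; exists [:: e] => //; rewrite /dwalk /= eqxx De_e. Qed.

Inductive mono (C : vertex E -> Prop) : T -> Prop :=
  Mono v s w t : dwalk v s -> dwalk w t -> walk_end v s = walk_end w t ->
    C (walk_end v s) -> mono C (sp v s * sp' w t).

(** A nonzero product of two monomials inherits the range vertex of one factor, namely the one that
    is reached from the range vertex of the other. The two hypotheses cover the two cases. *)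
Lemma mono_mul (A B C : vertex E -> Prop) :
  (forall v w, A v -> B w -> reach v w -> C w) ->
  (forall v w, A v -> B w -> reach w v -> C v) ->
  forall x y, mono A x -> mono B y -> kspan (mono C) (x * y).
Proof.
move=> AB BA _ _ [v s w t Ws Wt st As] [v' s' w' t' Ws' Wt' st' Bs'].
rewrite mulrA -(mulrA (sp v s)).
case: (sp'_sp_case (dwalkW Wt) (dwalkW Ws')) => [[wv [r s'E]]|[wv [r tE]]|->].
- subst v' s'; move: (Ws'); rewrite dwalk_cat => /andP[_ Wr].
  rewrite sp'_sp_prefix ?(dwalkW Ws') // -st -sp_cat ?st ?(dwalkW Wr) //.
  have E1 : walk_end v (s ++ r) = walk_end w (t ++ r) by rewrite !walk_end_cat st.
  apply: kspan_gen; constructor=> //; last 1 first.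
  + rewrite E1; apply: AB As Bs' _; rewrite st.
    by exists r => //; rewrite walk_end_cat.
  + by rewrite dwalk_cat Ws st.
  by rewrite E1 st'.
- subst v' t; move: (Wt); rewrite dwalk_cat => /andP[_ Wr].
  rewrite sp'_sp_suffix ?(dwalkW Wt) // -!mulrA.
  rewrite st' -sp'_cat -?st' ?(dwalkW Wr) //.
  have E1 : walk_end w (s' ++ r) = walk_end w' (t' ++ r) by rewrite !walk_end_cat st'.
  apply: kspan_gen; constructor=> //; last 1 first.
  + apply: BA As Bs' _; rewrite st.
    by exists r => //; rewrite walk_end_cat.
  + by rewrite dwalk_cat Wt' -st'.
  by rewrite st E1.
- by rewrite mulr0 mul0r; apply: kspan0.
Qed.

(** * Matrix units indexed by walks ending in a set of vertices *)

Section CornerUnits.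
Variables (A : pred (vertex E)) (q : vertex E -> T).
Hypothesis qq : forall v, A v -> q v * q v = q v.
Hypothesis Pq : forall v, A v -> P v * q v = q v.
Hypothesis q_sp : forall v e s, A v -> dwalk v (e :: s) ->
  A (walk_end v (e :: s)) -> q v * sp v (e :: s) = 0.
Hypothesis sp'_q : forall v e s, A v -> dwalk v (e :: s) ->
  A (walk_end v (e :: s)) -> sp' v (e :: s) * q v = 0.

(** Distinct walks can be comparable, and then the plain monomials are not orthogonal. Inserting
    [q], which kills every nontrivial walk between vertices of [A], makes them so. This is used with
    [into] outside of [C] and with [out] on [C]. *)
Inductive qmono : T -> Prop :=
  QMono v s w t : dwalk v s -> dwalk w t -> walk_end v s = walk_end w t ->
    A (walk_end v s) -> qmono (sp v s * q (walk_end v s) * sp' w t).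

Definition is_endwalk (p : vertex E * seq (edge E)) :=
  dwalk p.1 p.2 && A (walk_end p.1 p.2).
Definition endwalk : Type := {p | is_endwalk p}.
HB.instance Definition _ := Choice.on endwalk.

Lemma corner_orth (p p' : endwalk) :
  q (walk_end (val p).1 (val p).2) *
    (sp' (val p).1 (val p).2 * sp (val p').1 (val p').2) *
    q (walk_end (val p').1 (val p').2) =
  if p == p' then q (walk_end (val p).1 (val p).2) else 0.
Proof.
have /andP[Wp Ap] := valP p; have /andP[Wp' Ap'] := valP p'.
case: eqP => [<-|pp'].
  by rewrite sp'_sp ?(dwalkW Wp) // -mulrA Pq ?qq.
have {}pp' : val p <> val p' by move=> /val_inj.
case: (val p) pp' Wp Ap => v s; case: (val p') Wp' Ap' => v' t /= Wt At pp' Ws As.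
case: (sp'_sp_case (dwalkW Ws) (dwalkW Wt)) => [[E1 [r E2]]|[E1 [r E2]]|->].
- subst v' t; case: r Wt At pp' => [|e r] Wt At pp'; first by rewrite cats0 in pp'.
  rewrite sp'_sp_prefix ?(dwalkW Wt) // q_sp ?mul0r //.
    by move: Wt; rewrite dwalk_cat => /andP[].
  by rewrite -walk_end_cat.
- subst v' s; case: r Ws As pp' => [|e r] Ws As pp'; first by rewrite cats0 in pp'.
  rewrite sp'_sp_suffix ?(dwalkW Ws) // -mulrA sp'_q ?mulr0 //.
    by move: Ws; rewrite dwalk_cat => /andP[].
  by rewrite -walk_end_cat.
- by rewrite mulr0 mul0r.
Qed.

Lemma kspan_qmono_regular x : kspan qmono x ->
  exists2 z, kspan qmono z & x * z * x = x.
Proof.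
pose lab (p : endwalk) := walk_end (val p).1 (val p).2.
pose u (p : endwalk) := sp (val p).1 (val p).2 * q (lab p).
pose w (p : endwalk) := q (lab p) * sp' (val p).1 (val p).2.
have labA p : A (lab p) by case/andP: (valP p).
have uw i j : lab i = lab j ->
    u i * w j = sp (val i).1 (val i).2 * q (lab i) * sp' (val j).1 (val j).2.
  by move=> ij; rewrite /u /w -ij mulrA -(mulrA _ (q _) (q _)) qq ?labA.
have genE y : unit_gen u w lab y <-> qmono y.
  split=> [[i j ij]|[v s v' t Ws Wt st Ae]].
    rewrite uw //; have /andP[Wi Ai] := valP i; have /andP[Wj _] := valP j.
    exact: QMono.
  have Wi : is_endwalk (v, s) by rewrite /is_endwalk /= Ws.
  have Wj : is_endwalk (v', t) by rewrite /is_endwalk /= Wt -st.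
  by rewrite -(@uw (exist is_endwalk _ Wi) (exist is_endwalk _ Wj)).
have uq i : u i * q (lab i) = u i by rewrite /u -mulrA qq.
have wu i j : w i * u j = if i == j then q (lab i) else 0.
  by rewrite /u /w mulrA -(mulrA _ (sp' _ _)); apply: corner_orth.
move=> xq; have [] := @kspan_unit_regular _ _ _ _ u w q lab wu uq x.
  by apply: kspan_sub xq => y /genE yg; apply: kspan_gen.
move=> z zq xzx; exists z => //.
by apply: kspan_sub zq => y /genE yg; apply: kspan_gen.
Qed.

End CornerUnits.

Definition idl (A : vertex E -> Prop) := kspan (mono A).
Definition alg (A : vertex E -> Prop) := kspan (fun x => x = 1 \/ mono A x).

Lemma idl_alg A x : idl A x -> alg A x.
Proof. by apply: kspan_sub => y Ay; apply: kspan_gen; right. Qed.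

Lemma alg1 A : alg A 1. Proof. by apply: kspan_gen; left. Qed.

Lemma alg_subring A : subring_pred (alg A).
Proof.
split; [exact: alg1 | by move=> x y; apply: kspanB | apply: kspan_mul].
move=> x y [->|Ax] [->|Ay]; rewrite ?mul1r ?mulr1; try exact: alg1.
- by apply: kspan_gen; right.
- by apply: kspan_gen; right.
- by apply: idl_alg; apply: (mono_mul _ _ Ax Ay).
Qed.

Lemma alg_mono (A B : vertex E -> Prop) :
  (forall v, A v -> B v) -> forall x, alg A x -> alg B x.
Proof.
move=> AB; apply: kspan_sub => y [->|[v s w t Ws Wt st Ae]]; first exact: alg1.
by apply: kspan_gen; right; constructor=> //; apply: AB.
Qed.

Lemma idl_mono (A B : vertex E -> Prop) :
  (forall v, A v -> B v) -> forall x, idl A x -> idl B x.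
Proof.
move=> AB; apply: kspan_sub => y [v s w t Ws Wt st Ae].
by apply: kspan_gen; constructor=> //; apply: AB.
Qed.

(** * The ideal of a terminal component and its complementary subalgebra *)

Section Component.
Variables U C : {fset vertex E}.
Hypothesis CU : (C `<=` U)%fset.
Hypothesis predU : forall e, e \in De -> rng e \in U -> src e \in U.
Hypothesis termC : forall e,
  e \in De -> src e \in C -> rng e \in U -> rng e \in C.

Local Notation inU := (fun v => v \in U).
Local Notation inC := (fun v => v \in C).
Local Notation inU' := (fun v => (v \in U) && (v \notin C)).

Lemma reach_predU v w : reach v w -> w \in U -> v \in U.
Proof.
case=> s + <-; elim: s v => //= e s IH v; rewrite /dwalk /=.
case/andP=> /andP[/eqP <- Ws] /andP[De_e Ds] wU; apply: predU => //.
by apply: IH => //; rewrite /dwalk Ws.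
Qed.

Lemma reach_termC v w : reach v w -> v \in C -> w \in U -> w \in C.
Proof.
case=> s + <-; elim: s v => //= e s IH v; rewrite /dwalk /=.
case/andP=> /andP[/eqP <- Ws] /andP[De_e Ds] vC wU.
have dW : dwalk (rng e) s by rewrite /dwalk Ws.
by apply: IH => //; apply: termC => //; apply: reach_predU wU; exists s.
Qed.

Lemma idl_mull x y : alg inU x -> idl inC y -> idl inC (x * y).
Proof.
move: x y; apply: kspan_mul => x y [->|Ux] Cy.
  by rewrite mul1r; apply: kspan_gen.
apply: (mono_mul _ _ Ux Cy) => // v w vU wC wv.
exact: reach_termC wv wC vU.
Qed.

Lemma idl_mulr x y : idl inC x -> alg inU y -> idl inC (x * y).
Proof.
move: x y; apply: kspan_mul => x y Cx [->|Uy].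
  by rewrite mulr1; apply: kspan_gen.
apply: (mono_mul _ _ Cx Uy) => // v w vC wU vw.
exact: reach_termC vw vC wU.
Qed.

Lemma idlC_algU x : idl inC x -> alg inU x.
Proof.
move=> Cx; apply: idl_alg; apply: idl_mono Cx => v.
by move/fsubsetP: CU; apply.
Qed.

Lemma algU'_algU x : alg inU' x -> alg inU x.
Proof. by apply: alg_mono => v /andP[]. Qed.

Lemma alg_split x : alg inU x ->
  exists y z, [/\ alg inU' y, idl inC z & x = y + z].
Proof.
elim=> [|{}x x' _ [y [z [U'y Cz ->]]] _ [y' [z' [U'y' Cz' ->]]]
       |a {}x _ [y [z [U'y Cz ->]]]|{}x].
- by exists 0, 0; split; [apply: kspan0 | apply: kspan0 | rewrite addr0].
- by exists (y + y'), (z + z'); split; [apply: kspanD | apply: kspanD | rewrite addrACA].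
- by exists (a *: y), (a *: z); split; [apply: kspanZ | apply: kspanZ | rewrite scalerDr].
case=> [->|[v s w t Ws Wt st eU]].
  by exists 1, 0; split; [apply: alg1 | apply: kspan0 | rewrite addr0].
have [eC|eC] := boolP (walk_end v s \in C).
  exists 0, (sp v s * sp' w t); split; [exact: kspan0 | | by rewrite add0r].
  by apply: kspan_gen; constructor.
exists (sp v s * sp' w t), 0; split; [ | exact: kspan0 | by rewrite addr0].
by apply: kspan_gen; right; constructor=> //; rewrite eU.
Qed.

Lemma suitable_lift :
  (forall a, alg inU' a -> suitable (alg inU') a) ->
  (forall e j, alg inU' e -> e * e = e -> idl inC j ->
    suitable (alg inU) (e + j)) ->
  forall a, alg inU a -> suitable (alg inU) a.
Proof.
move=> exU' exI a /alg_split[b [i [U'b Ci aE]]].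
have [e [r [t [U'r U't ee er et]]]] := exU' b U'b.
have HB := alg_subring inU; have HB' := alg_subring inU'.
have [Ub Ur Ut] : [/\ alg inU b, alg inU r & alg inU t] by split; apply: algU'_algU.
have Ua : alg inU a by rewrite aE; apply: kspanD => //; apply: idlC_algU.
pose j := i * r - i * t.
have Cj : idl inC j by apply: kspanB; apply: idl_mulr.
have jU := idlC_algU Cj; have iU := idlC_algU Ci.
have E1 : a * r + (1 - a) * t = 1 + j.
  transitivity (b * r + (1 - b) * t + j); first by rewrite aE /j; non_commutative_ring.
  by rewrite -er -et [e + _]addrC subrK.
have U'e : alg inU' e by rewrite er; apply: subringM.
(* Subtracting [j] from both [r] and [t] lowers the sum [1 + j] by a j + (1 - a) j = j. So
   [a * (r - j)] and [(1 - a) * (t - j)] add up to 1, and the former still equals [e] modulo the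
   ideal. *)
apply: (@suitable_trans _ _ a (a * (r - j)) (r - j) (t - j)) => //.
- exact: subringB.
- exact: subringB.
- transitivity (1 + j - a * r - j + a * j); first by non_commutative_ring.
  by rewrite -E1; non_commutative_ring.
have -> : a * (r - j) = e + (i * r - a * j).
  by rewrite aE er; non_commutative_ring.
apply: exI => //; apply: kspanB; first exact: idl_mulr.
exact: idl_mull.
Qed.

(** For [v] outside [C] this projection singles out the walks that enter [C] with their first edge.
    For [v] in [C] it is the sum of (CK2) restricted to the edges of [De] that remain in [C]. *)
Definition into v : T :=
  \sum_(f <- De | (src f == v) && (rng f \in C)) S f * S' f.

Lemma into_S e : e \in De -> rng e \in C -> into (src e) * S e = S e.
Proof.
move=> De_e eC; rewrite /into big_mkcond (big_fsetD1 e) //= eqxx eC /=.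
rewrite mulrDl -mulrA (cohn_S'S coh) eqxx (cohn_SP coh).
rewrite mulr_suml big1_fset ?addr0 // => f; rewrite !inE => /andP[fe _] _.
by case: ifP => _; rewrite ?mul0r // -mulrA (cohn_S'S coh) (negbTE fe) mulr0.
Qed.

Lemma into_S0 v e : rng e \notin C -> into v * S e = 0.
Proof.
move=> eC; rewrite /into mulr_suml big1 // => f /andP[_ fC].
rewrite -mulrA (cohn_S'S coh); case: eqP => [fe|]; last by rewrite mulr0.
by rewrite fe (negbTE eC) in fC.
Qed.

Lemma S'_into e : e \in De -> rng e \in C -> S' e * into (src e) = S' e.
Proof.
move=> De_e eC; rewrite /into big_mkcond (big_fsetD1 e) //= eqxx eC /=.
rewrite mulrDr mulrA (cohn_S'S coh) eqxx (cohn_PS' coh).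
rewrite mulr_sumr big1_fset ?addr0 // => f; rewrite !inE => /andP[fe _] _.
case: ifP => _; rewrite ?mulr0 // mulrA (cohn_S'S coh) eq_sym (negbTE fe).
by rewrite mul0r.
Qed.

Lemma S'_into0 v e : rng e \notin C -> S' e * into v = 0.
Proof.
move=> eC; rewrite /into mulr_sumr big1 // => f /andP[_ fC].
rewrite mulrA (cohn_S'S coh); case: eqP => [fe|]; last by rewrite mul0r.
by rewrite -fe (negbTE eC) in fC.
Qed.

Lemma P_into v : P v * into v = into v.
Proof.
rewrite /into mulr_sumr; apply: eq_bigr => f /andP[/eqP <- _].
by rewrite mulrA (cohn_PS coh).
Qed.

Lemma into_P v : into v * P v = into v.
Proof.
rewrite /into mulr_suml; apply: eq_bigr => f /andP[/eqP <- _].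
by rewrite -mulrA (cohn_S'P coh).
Qed.

Lemma into_idem v : into v * into v = into v.
Proof.
rewrite {2}/into mulr_sumr [RHS]/into big_seq_cond [RHS]big_seq_cond.
apply: eq_bigr => f /and3P[fD /eqP <- fC].
by rewrite mulrA into_S.
Qed.

Lemma into_ortho v w : v != w -> into v * into w = 0.
Proof.
by move=> vw; rewrite -into_P -(P_into w) -mulrA (mulrA (P v)) PPn // mul0r mulr0.
Qed.

Definition outU' v := (v \in U) && (v \notin C).

Lemma dwalk_consE v e s : dwalk v (e :: s) ->
  [/\ src e = v, e \in De & dwalk (rng e) s].
Proof. by rewrite /dwalk /= => /andP[/andP[/eqP <- ->] /andP[-> ->]]. Qed.

Lemma walk_outU' v s : dwalk v s -> outU' (walk_end v s) -> outU' v.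
Proof.
move=> Ws /andP[eU eC]; have rv : reach v (walk_end v s) by exists s.
rewrite /outU' (reach_predU rv eU) /=; apply: contra eC => vC.
exact: reach_termC rv vC eU.
Qed.

Lemma into_sp v e s : outU' v -> dwalk v (e :: s) ->
  outU' (walk_end v (e :: s)) -> into v * sp v (e :: s) = 0.
Proof.
move=> _ /dwalk_consE[_ _ Ws] /(walk_outU' Ws)/andP[_ eC] /=.
by rewrite mulrA into_S0 ?mul0r.
Qed.

Lemma sp'_into v e s : outU' v -> dwalk v (e :: s) ->
  outU' (walk_end v (e :: s)) -> sp' v (e :: s) * into v = 0.
Proof.
move=> _ /dwalk_consE[_ _ Ws] /(walk_outU' Ws)/andP[_ eC] /=.
by rewrite -mulrA S'_into0 ?mulr0.
Qed.

Local Notation Phi := (kspan (qmono outU' into)).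
Local Notation xwalk := (endwalk outU').

Definition uin (p : xwalk) :=
  sp (val p).1 (val p).2 * into (walk_end (val p).1 (val p).2).
Definition win (p : xwalk) :=
  into (walk_end (val p).1 (val p).2) * sp' (val p).1 (val p).2.

Lemma xwalkP (p : xwalk) : dwalk (val p).1 (val p).2 /\
  outU' (walk_end (val p).1 (val p).2).
Proof. by case/andP: (valP p). Qed.

Lemma uin_win_Phi p p' : Phi (uin p * win p').
Proof.
have [Wp Ap] := xwalkP p; have [Wp' Ap'] := xwalkP p'.
rewrite /uin /win mulrA -(mulrA (sp _ _)).
have [E1|E1] := eqVneq (walk_end (val p).1 (val p).2)
                      (walk_end (val p').1 (val p').2).
  by rewrite -E1 into_idem; apply: kspan_gen; constructor.
by rewrite into_ortho // mulr0 mul0r; apply: kspan0.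
Qed.

Lemma win_uin p p' : win p * uin p' =
  if p == p' then into (walk_end (val p).1 (val p).2) else 0.
Proof.
rewrite /uin /win mulrA -(mulrA _ (sp' _ _)).
exact: (corner_orth (fun v _ => into_idem v) (fun v _ => P_into v)
          into_sp sp'_into).
Qed.

Definition unitC : T := \sum_(w <- C) P w.
(** Approximate left units of the ideal. A walk ending in [C] either starts there, and [unitC] fixes
    it, or it consists of a walk [p] outside [C] followed by an edge into [C], and [uin p * win p]
    fixes it. *)
Definition unit0 (A : {fset xwalk}) : T :=
  unitC + \sum_(p <- A) uin p * win p.

Lemma unitC_P w : w \in C -> unitC * P w = P w.
Proof.
move=> wC; rewrite /unitC mulr_suml (big_fsetD1 w) //= PP.
rewrite big1_fset ?addr0 // => v; rewrite !inE => /andP[vw _] _.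
exact: PPn.
Qed.

Lemma xwalk_start (p : xwalk) : (val p).1 \notin C.
Proof. by have [Wp /(walk_outU' Wp)/andP[]] := xwalkP p. Qed.

Lemma unitC_uin p : unitC * uin p = 0.
Proof.
have [/dwalkW Wp _] := xwalkP p.
rewrite /uin -(P_sp Wp) !mulrA /unitC mulr_suml big1_seq ?mul0r // => w /= wC.
rewrite PPn //; apply: contraTneq wC => ->; exact: xwalk_start.
Qed.

Lemma win_unitC p : win p * unitC = 0.
Proof.
have [/dwalkW Wp _] := xwalkP p.
rewrite /win -(sp'_P Wp) -!mulrA /unitC mulr_sumr big1_seq ?mulr0 // => w /= wC.
rewrite PPn //; apply: contraTneq wC => <-; exact: xwalk_start.
Qed.

Lemma unitC_idem : unitC * unitC = unitC.
Proof.
by rewrite {2}/unitC mulr_sumr; apply: eq_big_seq => w wC; rewrite unitC_P.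
Qed.

Lemma uin_into p : uin p * into (walk_end (val p).1 (val p).2) = uin p.
Proof. by rewrite /uin -mulrA into_idem. Qed.

Lemma unit0_uin (A : {fset xwalk}) p : p \in A -> unit0 A * uin p = uin p.
Proof.
move=> pA; rewrite mulrDl unitC_uin add0r mulr_suml (big_fsetD1 p) //=.
rewrite -mulrA win_uin eqxx uin_into big1_fset ?addr0 // => p' + _.
rewrite !inE => /andP[/negbTE pp' _].
by rewrite -mulrA win_uin pp' mulr0.
Qed.

Lemma unit0_unitC A : unit0 A * unitC = unitC.
Proof.
rewrite mulrDl unitC_idem mulr_suml big1 ?addr0 // => p _.
by rewrite -mulrA win_unitC mulr0.
Qed.

Lemma unit0_idem A : unit0 A * unit0 A = unit0 A.
Proof.
rewrite {2}/unit0 mulrDr unit0_unitC mulr_sumr; congr (_ + _).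
by apply: eq_big_seq => p pA; rewrite mulrA unit0_uin.
Qed.

Lemma into_idl v s w t : dwalk v s -> dwalk w t -> walk_end v s = walk_end w t ->
  idl inC (sp v s * into (walk_end v s) * sp' w t).
Proof.
move=> Ws Wt st; rewrite /into mulr_sumr mulr_suml big_seq_cond.
apply: kspan_sum => f /and3P[fD /eqP fv fC].
have Wf : dwalk (walk_end v s) [:: f] by rewrite /dwalk /= fv eqxx fD.
have Wf' : dwalk (walk_end w t) [:: f] by rewrite -st.
have -> : sp v s * (S f * S' f) * sp' w t = sp v (s ++ [:: f]) * sp' w (t ++ [:: f]).
  rewrite sp_cat ?(dwalkW Wf) // sp'_cat ?(dwalkW Wf') //=.
  by rewrite (cohn_SP coh) (cohn_PS' coh) !mulrA.
apply: kspan_gen; constructor.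
- by rewrite dwalk_cat Ws.
- by rewrite dwalk_cat Wt.
- by rewrite !walk_end_cat st.
- by rewrite walk_end_cat.
Qed.

Lemma Phi_idl x : Phi x -> idl inC x.
Proof.
elim=> [|{}x y _ Ix _ Iy|a {}x _ Ix|_ [v s w t Ws Wt st _]].
- exact: kspan0.
- exact: kspanD.
- exact: kspanZ.
- exact: into_idl.
Qed.

Lemma P_idl v : v \in C -> idl inC (P v).
Proof.
by move=> vC; rewrite -(PP v); apply: kspan_gen; apply: (@Mono _ v [::] v [::]).
Qed.

Lemma unit0_idl A : idl inC (unit0 A).
Proof.
apply: kspanD; last by apply: kspan_sum => p _; apply: Phi_idl; apply: uin_win_Phi.
by rewrite /unitC big_seq; apply: kspan_sum => w wC; apply: P_idl.
Qed.

(** The index [p] is the part of the walk before its first edge into [C]. *)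
Lemma walk_into_C v s : dwalk v s -> v \in U -> walk_end v s \in C ->
  v \in C \/ exists2 p, (val p).1 = v & sp v s = uin p * (win p * sp v s).
Proof.
elim: s v => [|e s IH] v Ws vU eC; first by left.
have [ev eD Ws'] := dwalk_consE Ws; subst v.
have [vC|vC] := boolP (src e \in C); [by left | right].
have rU : rng e \in U.
  apply: (@reach_predU _ (walk_end (rng e) s)); first by exists s.
  by move/fsubsetP: CU; apply.
have [rC|rC] := boolP (rng e \in C).
  have Wp : is_endwalk outU' (src e, [::]) by rewrite /is_endwalk /= /outU' vU.
  exists (exist (is_endwalk outU') _ Wp) => //.
  by rewrite /uin /win /= P_into into_P !mulrA into_idem into_S.
have [rC'|[p pv pE]] := IH _ Ws' rU eC; first by rewrite rC' in rC.
have [] := xwalkP p; rewrite pv => Wp Ap.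
have Wp' : is_endwalk outU' (src e, e :: (val p).2).
  by rewrite /is_endwalk /=; move: Wp; rewrite /dwalk /= eqxx eD => ->.
exists (exist (is_endwalk outU') _ Wp') => //.
rewrite /= {1}pE /uin /win /= pv.
set u := sp _ _; set w := sp' _ _; set q := into _.
transitivity (S e * (u * q * (q * w * P (rng e) * sp (rng e) s))).
  by rewrite -(mulrA _ (P _)) P_sp ?(dwalkW Ws').
transitivity (S e * u * q * (q * w * (S' e * S e) * sp (rng e) s)).
  by rewrite (cohn_S'S coh) eqxx !mulrA.
by rewrite !mulrA.
Qed.

Lemma unit0_fix j : idl inC j -> exists A0 : {fset xwalk},
  forall A : {fset xwalk}, (A0 `<=` A)%fset -> unit0 A * j = j.
Proof.
elim=> [|{}j j' _ [A jA] _ [A' jA']|a {}j _ [A jA]|_ [v s w t Ws Wt st eC]].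
- by exists fset0 => A _; rewrite mulr0.
- exists (A `|` A')%fset => B AB; rewrite mulrDr jA ?jA' //.
    exact: fsubset_trans (fsubsetUr _ _) AB.
  exact: fsubset_trans (fsubsetUl _ _) AB.
- by exists A => B AB; rewrite -scalerAr jA.
have vU : v \in U.
  apply: (@reach_predU _ (walk_end v s)); first by exists s.
  by move/fsubsetP: CU; apply.
have [vC|[p _ pE]] := walk_into_C Ws vU eC.
  exists fset0 => A _; rewrite -(P_sp (dwalkW Ws)) !mulrA -(unitC_P vC) !mulrA.
  by rewrite unit0_unitC.
exists [fset p]%fset => A; rewrite fsub1set => pA.
by rewrite pE -(mulrA (uin p)) (mulrA (unit0 A) (uin p)) unit0_uin.
Qed.

(** A ghost part longer than [p] leaves a remainder that meets [into] and vanishes by [sp'_into].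
    Otherwise the monomial changes the walk [p] but not its end vertex. *)
Lemma alg_uin x p : alg outU' x ->
  kspan (fun y => exists p, y = uin p) (x * uin p).
Proof.
elim=> [|{}x y _ Ix _ Iy|a {}x _ Ix|{}x [->|[v s w t Ws Wt st eU]]].
- by rewrite mul0r; apply: kspan0.
- by rewrite mulrDl; apply: kspanD.
- by rewrite -scalerAl; apply: kspanZ.
- by rewrite mul1r; apply: kspan_gen; exists p.
have [Wp Ap] := xwalkP p; rewrite /uin.
case: (val p) Wp Ap => v' r /= Wr Ar.
rewrite !mulrA -(mulrA (sp v s)).
case: (sp'_sp_case (dwalkW Wt) (dwalkW Wr)) => [[wv [r' E1]]|[wv [r' E1]]|->].
- subst v' r; move: Wr (Wr); rewrite {1}dwalk_cat => /andP[_ Wr'] Wr.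
  rewrite sp'_sp_prefix ?(dwalkW Wr) // -st -sp_cat ?st ?(dwalkW Wr') //.
  rewrite walk_end_cat -st -walk_end_cat.
  have Wp : is_endwalk outU' (v, s ++ r').
    by rewrite /is_endwalk /= dwalk_cat Ws st Wr' walk_end_cat st -walk_end_cat.
  by apply: kspan_gen; exists (exist (is_endwalk outU') _ Wp).
- subst v' t; case: r' Wt st => [|e r'] Wt st.
    rewrite cats0 sp'_sp ?(dwalkW Wr) //.
    rewrite cats0 in st; rewrite -st sp_P.
    have Wp : is_endwalk outU' (v, s) by rewrite /is_endwalk /= Ws.
    by apply: kspan_gen; exists (exist (is_endwalk outU') _ Wp).
  rewrite sp'_sp_suffix ?(dwalkW Wt) // -mulrA sp'_into ?mulr0; first exact: kspan0.
  + by [].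
  + by move: Wt; rewrite dwalk_cat => /andP[].
  + by rewrite -walk_end_cat -st.
- by rewrite mulr0 mul0r; apply: kspan0.
Qed.

Lemma alg_unitC x : alg outU' x -> exists c : K, x * unitC = c *: unitC.
Proof.
elim=> [|{}x y _ [c cE] _ [d dE]|a {}x _ [c cE]|{}x [->|[v s w t Ws Wt st eU]]].
- by exists 0; rewrite mul0r scale0r.
- by exists (c + d); rewrite mulrDl cE dE scalerDl.
- by exists (a * c); rewrite -scalerAl cE scalerA.
- by exists 1; rewrite mul1r scale1r.
exists 0; rewrite scale0r -(sp'_P (dwalkW Wt)) -!mulrA /unitC.
rewrite mulr_sumr big1_seq ?mulr0 // => u /= uC; rewrite PPn //.
apply: contraTneq uC => <-.
by rewrite st in eU; case/andP: (walk_outU' Wt eU).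
Qed.

(** [x] multiplies [unitC] by a scalar and sends each [uin p] to a combination of elements [uin p'].
    The factor [1 - unit0 A] kills [unitC] and the [uin p'] with [p'] in [A] and fixes the others,
    so only products [uin p' * win p] are left. *)
Lemma unit0_Phi A x : alg outU' x -> Phi ((1 - unit0 A) * x * unit0 A).
Proof.
move=> Ux; have [c cE] := alg_unitC Ux.
rewrite mulrDr -[_ * x * unitC]mulrA cE -scalerAr mulrBl mul1r unit0_unitC.
rewrite subrr scaler0 add0r mulr_sumr; apply: kspan_sum => p _.
rewrite mulrA -[_ * x * uin p]mulrA.
elim: (alg_uin p Ux) => [|y z _ Iy _ Iz|a y _ Iy|_ [p' ->]].
- by rewrite mulr0 mul0r; apply: kspan0.
- by rewrite mulrDr mulrDl; apply: kspanD.
- by rewrite -scalerAr -scalerAl; apply: kspanZ.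
have [p'A|p'A] := boolP (p' \in A).
  by rewrite mulrBl mul1r unit0_uin // subrr mul0r; apply: kspan0.
have u0 : unit0 A * uin p' = 0.
  rewrite /unit0 mulrDl unitC_uin add0r mulr_suml big1_seq // => p2 /= p2A.
  rewrite -mulrA win_uin; case: eqP p'A => [<-|]; rewrite ?mulr0 //.
  by rewrite p2A.
by rewrite mulrBl mul1r u0 subr0; apply: uin_win_Phi.
Qed.

(** As [e] is idempotent, it maps k0 R + e k0 R into itself. This right ideal is k0 R + y R with y =
    (1 - k0) e k0. By [unit0_Phi] the element y is a combination of matrix units, hence von Neumann
    regular, which provides an idempotent [h] orthogonal to [k0] with h R = y R. Then k = k0 + h. *)
Lemma invariant_unit e j : alg outU' e -> e * e = e -> idl inC j ->
  exists k, [/\ idl inC k, k * k = k, k * j = j & k * e * k = e * k].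
Proof.
move=> Ue ee Cj; have [A /(_ A (fsubset_refl A)) kj] := unit0_fix Cj.
have k0k0 := unit0_idem A; have Ck0 := unit0_idl A; have Py := unit0_Phi A Ue.
move: (unit0 A) kj k0k0 Ck0 Py => k0 kj k0k0 Ck0 Py.
have [z Pz] := kspan_qmono_regular (fun v _ => into_idem v)
  (fun v _ => P_into v) into_sp sp'_into Py.
move: Py; have k0y : k0 * ((1 - k0) * e * k0) = 0.
  by rewrite !mulrA mulrBr mulr1 k0k0 subrr !mul0r.
have yE : (1 - k0) * e * k0 = e * k0 - k0 * (e * k0) by non_commutative_ring.
move: ((1 - k0) * e * k0) k0y yE => y k0y yE Py yzy.
pose h := y * z * (1 - k0).
have hk0 : h * k0 = 0 by rewrite /h -mulrA mulrBl mul1r k0k0 subrr mulr0.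
have k0h : k0 * h = 0 by rewrite /h (mulrA k0) (mulrA k0) k0y !mul0r.
have hy : h * y = y.
  transitivity (y * z * y - y * z * (k0 * y)); first by rewrite /h; non_commutative_ring.
  by rewrite k0y mulr0 subr0.
have hj : h * j = 0 by rewrite /h -mulrA mulrBl mul1r kj subrr mulr0.
have kek0 : (k0 + h) * (e * k0) = e * k0.
  have ek0 : e * k0 = k0 * (e * k0) + y by rewrite yE addrC subrK.
  transitivity (k0 * (e * k0) + h * (k0 * (e * k0) + y)).
    by rewrite -ek0 mulrDl.
  by rewrite mulrDr (mulrA h) hk0 mul0r add0r hy -ek0.
have key : (k0 + h) * (e * y) = e * y.
  have -> : e * y = e * k0 - e * k0 * (e * k0).
    transitivity (e * e * k0 - e * k0 * (e * k0)); last by rewrite ee.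
    by rewrite yE; non_commutative_ring.
  by rewrite mulrBr (mulrA _ (e * k0)) kek0.
exists (k0 + h); split.
- apply: kspanD => //; rewrite /h -!mulrA; apply: idl_mulr.
    exact: Phi_idl.
  apply: (subringM (alg_subring _)); first by apply: idlC_algU; apply: Phi_idl.
  by apply: (subringB (alg_subring _)); [apply: alg1 | apply: idlC_algU].
- rewrite mulrDl !mulrDr k0k0 k0h hk0 addr0 add0r; congr (_ + _).
  by rewrite {2}/h !mulrA hy.
- by rewrite mulrDl kj hj addr0.
rewrite -[LHS]mulrA (mulrDr e) (mulrDr (k0 + h)) kek0; congr (_ + _).
have -> : e * h = e * y * (z * (1 - k0)) by rewrite /h !mulrA.
by rewrite mulrA key.
Qed.

(** For [k] as in [invariant_unit], the block of [e + j] at [1 - k] does not see [j] and is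
    idempotent because [e] is. So [suitable_triangular] leaves only the corner at [k], which lies in
    the ideal. *)
Lemma suitable_reduce :
  (forall a k, idl inC a -> idl inC k -> k * k = k -> k * a = a -> a * k = a ->
     suitable (alg inU) a) ->
  forall e j, alg inU' e -> e * e = e -> idl inC j -> suitable (alg inU) (e + j).
Proof.
move=> exC e j Ue ee Cj.
have [k [Ck kk kj ke]] := invariant_unit Ue ee Cj.
have HB := alg_subring inU.
have Uk := idlC_algU Ck; have Ue' := algU'_algU Ue; have Uj := idlC_algU Cj.
have Ua : alg inU (e + j) by apply: kspanD.
have kn : (1 - k) * (e + j) = (1 - k) * e.
  by rewrite mulrDr [(1 - k) * j]mulrBl mul1r kj subrr addr0.
apply: (suitable_triangular HB Ua Uk kk).
- by rewrite mulrDr !mulrDl kj ke.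
- rewrite kn; transitivity ((1 - k) * (e * e) - (e * k - k * e * k) * e).
    non_commutative_ring.
  by rewrite ee ke subrr mul0r subr0.
apply: (exC _ k) => //.
- by apply: idl_mulr => //; apply: idl_mulr.
- by rewrite !mulrA kk.
- by rewrite -(mulrA _ k k) kk.
Qed.

(** The defect of (CK2) at [v] relative to the edges that remain in [C]. On [C] it annihilates all
    nontrivial walks within [C], as [CornerUnits] requires. *)
Definition out v : T := P v - into v.

Local Notation J := (kspan (qmono inC out)).

Lemma out_idem v : out v * out v = out v.
Proof.
by rewrite /out mulrBl !mulrBr PP P_into into_P into_idem subrr subr0.
Qed.

Lemma P_out v : P v * out v = out v.
Proof. by rewrite /out mulrBr PP P_into. Qed.

Lemma edge_inC v e s : v \in C -> dwalk v (e :: s) ->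
  walk_end v (e :: s) \in C -> [/\ src e = v, e \in De & rng e \in C].
Proof.
move=> vC /dwalk_consE[ev eD Ws] /= eC; split=> //.
apply: termC; rewrite ?ev //; apply: (@reach_predU _ (walk_end (rng e) s)).
  by exists s.
by move/fsubsetP: CU; apply.
Qed.

Lemma out_sp v e s : v \in C -> dwalk v (e :: s) ->
  walk_end v (e :: s) \in C -> out v * sp v (e :: s) = 0.
Proof.
move=> vC Ws /(edge_inC vC Ws)[ev eD eC] /=; subst v.
by rewrite /out mulrA mulrBl into_S // (cohn_PS coh) subrr mul0r.
Qed.

Lemma sp'_out v e s : v \in C -> dwalk v (e :: s) ->
  walk_end v (e :: s) \in C -> sp' v (e :: s) * out v = 0.
Proof.
move=> vC Ws /(edge_inC vC Ws)[ev eD eC] /=; subst v.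
by rewrite /out -mulrA mulrBr S'_into // (cohn_S'P coh) subrr mulr0.
Qed.

Lemma J_regular x : J x -> exists2 z, J z & x * z * x = x.
Proof.
exact: (kspan_qmono_regular (fun v _ => out_idem v) (fun v _ => P_out v)
          out_sp sp'_out).
Qed.

Lemma J_idl x : J x -> idl inC x.
Proof.
elim=> [|{}x y _ Ix _ Iy|a {}x _ Ix|_ [v s w t Ws Wt st eC]].
- exact: kspan0.
- exact: kspanD.
- exact: kspanZ.
rewrite /out mulrBr sp_P mulrBl; apply: kspanB; last exact: into_idl.
exact: kspan_gen.
Qed.

Lemma sp_alg v s : dwalk v s -> walk_end v s \in U -> alg inU (sp v s).
Proof.
move=> Ws eU; rewrite -(sp_P v s); apply: kspan_gen; right.
by apply: (@Mono _ v s (walk_end v s) [::]).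
Qed.

Lemma sp'_alg v s : dwalk v s -> walk_end v s \in U -> alg inU (sp' v s).
Proof.
move=> Ws eU; rewrite -(P_sp' v s); apply: kspan_gen; right.
by apply: (@Mono _ (walk_end v s) [::] v s).
Qed.

Lemma S_alg e : e \in De -> rng e \in U -> alg inU (S e).
Proof.
move=> eD eU; have := @sp_alg (src e) [:: e].
by rewrite /= (cohn_SP coh); apply; rewrite // /dwalk /= eqxx eD.
Qed.

Definition hit (c : T) := exists (x y : T) w,
  [/\ alg inU x, alg inU y, w \in C & x * c * y = P w].

Lemma hitM (c x y : T) : alg inU x -> alg inU y -> hit (x * c * y) -> hit c.
Proof.
move=> Us Ut [s' [t' [w [Us' Ut' wC E1]]]]; exists (s' * x), (y * t'), w.
by split=> //; [apply: subringM | apply: subringM | rewrite -E1 !mulrA];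
  do ?exact: alg_subring.
Qed.

(** * Strongly connected components with incomparable closed walks *)

Section PurelyInfinite.

Hypothesis connC : forall v w, v \in C -> w \in C -> reach v w.
Hypothesis forkC : forall w, w \in C -> exists c1 c2,
  [/\ dwalk w c1, dwalk w c2, walk_end w c1 = w, walk_end w c2 = w
    & ~~ prefix c1 c2 && ~~ prefix c2 c1].

Lemma sp'_sp_incomp w s t : dwalk w s -> dwalk w t ->
  ~~ prefix s t -> ~~ prefix t s -> sp' w s * sp w t = 0.
Proof.
move=> Ws Wt; case: (sp'_sp_case (dwalkW Ws) (dwalkW Wt)) => [[_ [r ->]]|[_ [r ->]]|//].
  by rewrite prefix_prefix.
by move=> _; rewrite prefix_prefix.
Qed.

(** A monomial factors through [w] by strong connectedness. For sums, the incomparable closed walks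
    [c1] and [c2] provide two orthogonal copies of [P w] inside [P w], one for each summand. *)
Lemma idl_through x w : idl inC x -> w \in C -> exists tau sg,
  [/\ alg inU tau, alg inU sg, tau * P w = tau, P w * sg = sg & tau * sg = x].
Proof.
move=> Cx wC; have wU : w \in U by move/fsubsetP: CU; apply.
have HB := alg_subring inU.
have [c1 [c2 [W1 W2 e1 e2 /andP[p12 p21]]]] := forkC wC.
have o12 := sp'_sp_incomp W1 W2 p12 p21.
have o21 := sp'_sp_incomp W2 W1 p21 p12.
have o11 := sp'_sp (dwalkW W1); have o22 := sp'_sp (dwalkW W2).
rewrite e1 in o11; rewrite e2 in o22.
elim: Cx => [|{}x y _ [tx [sx [tU sU tP Ps ts]]] _ [ty [sy [tU' sU' tP' Ps' ts']]]
   |a {}x _ [tau [sg [tU sU tP Ps ts]]]|_ [v s v' t Ws Wt st eC]].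
- by exists 0, 0; split; rewrite ?mulr0 ?mul0r //; apply: kspan0.
- exists (tx * sp' w c1 + ty * sp' w c2), (sp w c1 * sx + sp w c2 * sy).
  have [U1 U2 U1' U2'] : [/\ alg inU (sp w c1), alg inU (sp w c2),
      alg inU (sp' w c1) & alg inU (sp' w c2)].
    by split; (apply: sp_alg || apply: sp'_alg); rewrite ?e1 ?e2.
  split; [in_subring | in_subring | | | ].
  + by rewrite mulrDl -!mulrA !sp'_P ?dwalkW.
  + by rewrite mulrDr !mulrA !P_sp ?dwalkW.
  rewrite mulrDl !mulrDr -!mulrA (mulrA (sp' w c1) (sp w c1)) o11.
  rewrite (mulrA (sp' w c1) (sp w c2)) o12 (mulrA (sp' w c2) (sp w c1)) o21.
  rewrite (mulrA (sp' w c2) (sp w c2)) o22 !mul0r !mulr0 addr0 add0r.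
  by rewrite Ps Ps' ts ts'.
- exists (a *: tau), sg; split=> //; rewrite -?scalerAl ?tP ?ts //.
  exact: kspanZ.
have [r Wr rE] := connC wC eC.
have eU : walk_end v s \in U by move/fsubsetP: CU; apply.
have eU' := eU; rewrite st in eU'.
exists (sp v s * sp' w r), (sp w r * sp' v' t); split.
- by apply: (subringM HB); [apply: sp_alg | apply: sp'_alg; rewrite ?rE].
- by apply: (subringM HB); [apply: sp_alg; rewrite ?rE | apply: sp'_alg].
- by rewrite -mulrA sp'_P ?dwalkW.
- by rewrite mulrA P_sp ?dwalkW.
rewrite mulrA -(mulrA (sp v s)) sp'_sp ?dwalkW // rE sp_P //.
Qed.

(** If x c y = P w for c = a - a a, then g = c y x is an idempotent equivalent to [P w]. The rest
    [k - g] factors through [P w] by [idl_through], hence through [g], which is the room that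
    [suitable_absorb] asks for. *)
Lemma suitable_hit a k : idl inC a -> idl inC k ->
  k * k = k -> k * a = a -> a * k = a -> hit (a - a * a) ->
  suitable (alg inU) a.
Proof.
move=> Ca Ck kk ka ak [s0 [t0 [w [Us0 Ut0 wC E0]]]].
have HB := alg_subring inU.
have Ua := idlC_algU Ca; have Uk := idlC_algU Ck.
have wU : w \in U by move/fsubsetP: CU; apply.
have UP : alg inU (P w) by apply: (@sp_alg w [::]).
pose c := a - a * a.
have ck : k * c = c by rewrite /c mulrBr mulrA !ka.
have Uc : alg inU c by rewrite /c; in_subring.
have [x [y [Ux Uy Px yP [xk xcy]]]] : exists x y, [/\ alg inU x, alg inU y,
    P w * x = x, y * P w = y & x * k = x /\ x * c * y = P w].
  exists (P w * s0 * k), (t0 * P w).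
  split; [in_subring | in_subring | by rewrite !mulrA PP | by rewrite -mulrA PP | split].
    by rewrite -mulrA kk.
  transitivity (P w * (s0 * (k * c) * t0) * P w); first by rewrite !mulrA.
  by rewrite ck E0 !PP.
pose g := c * y * x.
have gg : g * g = g.
  transitivity (c * y * (x * c * y) * x); first by rewrite /g !mulrA.
  by rewrite xcy -(mulrA (c * y)) Px.
have Cg : idl inC g.
  have Cc : idl inC c by apply: kspanB => //; apply: idl_mulr.
  by apply: idl_mulr => //; apply: idl_mulr.
have gk : g * k = g by rewrite /g -mulrA xk.
have kg : k * g = g by rewrite /g !mulrA ck.
have Cm : idl inC (k - g) by apply: kspanB.
have [t1 [s1 [Ut1 Us1 t1P Ps1 ts1]]] := idl_through Cm wC.
have mm : (k - g) * (k - g) = k - g.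
  by rewrite mulrBl !mulrBr kk kg gk gg subrr subr0.
have Um := idlC_algU Cm; have Ug := idlC_algU Cg.
apply: (@suitable_absorb _ _ a k g (y * x) (c * y * s1 * (k - g))
  ((k - g) * t1 * x)) => //; try by in_subring.
- by rewrite /g mulrA.
- transitivity (c * y * (x * c * y) * s1 * (k - g)); first by rewrite /g !mulrA.
  by rewrite xcy -(mulrA (c * y)) Ps1.
- by rewrite -(mulrA _ (k - g) (k - g)) mm.
- transitivity ((k - g) * t1 * (x * c * y) * x); first by rewrite /g !mulrA.
  by rewrite xcy -(mulrA _ t1) t1P.
- by rewrite !mulrA mm.
transitivity ((k - g) * t1 * (x * c * y) * s1 * (k - g)); first by rewrite !mulrA.
by rewrite xcy -(mulrA _ t1) t1P -(mulrA _ t1) ts1 mm mm.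
Qed.

Definition loop_term w x := x = 0 \/ exists k s,
  [/\ dwalk w s, walk_end w s = w, s != [::] & x = k *: sp w s].

Fixpoint loop_comb w n x : Prop :=
  if n is m.+1 then
    exists y z, [/\ loop_comb w m y, loop_term w z & x = y + z]
  else x = 0.

Lemma prefix_comparable (s t r : seq (edge E)) :
  prefix s r -> prefix t r -> prefix s t || prefix t s.
Proof.
wlog st : s t / (size s <= size t)%N.
  by move=> W sr tr; case/orP: (leq_total (size s) (size t)) => st;
     [|rewrite orbC]; apply: W.
rewrite !prefixE => /eqP sE /eqP tE; apply/orP; left.
by rewrite -{1}tE take_takel // sE.
Qed.

(* [c] a prefix of [s ++ c] forces [c] to be a prefix of the periodic word
   [s ++ s ++ ...]; two incomparable words cannot both have this property. *)
Lemma prefix_shift (s c : seq (edge E)) n : prefix c (s ++ c) ->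
  prefix c (flatten (nseq n s) ++ c).
Proof.
move=> /prefixP[r cE]; elim: n => [|n /prefixP[r' IH]] /=; first exact: prefix_refl.
by rewrite -catA IH catA cE -catA prefix_prefix.
Qed.

Lemma prefix_shift_comparable (s c1 c2 : seq (edge E)) : s != [::] ->
  prefix c1 (s ++ c1) -> prefix c2 (s ++ c2) -> prefix c1 c2 || prefix c2 c1.
Proof.
move=> s0 p1 p2; pose n := (size c1 + size c2)%N.
have sz : (n <= size (flatten (nseq n s)))%N.
  rewrite size_flatten /shape map_nseq sumn_nseq leq_pmull //.
  by rewrite lt0n size_eq0.
have pre c : (size c <= n)%N -> prefix c (s ++ c) -> prefix c (flatten (nseq n s)).
  move=> cn /(prefix_shift n); rewrite !prefixE takel_cat //.
  exact: leq_trans cn sz.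
by apply: (@prefix_comparable _ _ (flatten (nseq n s))); apply: pre => //;
  rewrite /n ?leq_addr ?leq_addl.
Qed.

Lemma loop_term_conj w c x : dwalk w c -> walk_end w c = w ->
  loop_term w x -> loop_term w (sp' w c * x * sp w c).
Proof.
move=> Wc cw [->|[k [s [Ws sw s0 ->]]]]; first by left; rewrite mulr0 mul0r.
rewrite -scalerAr -scalerAl -mulrA.
have E1 : sp w s * sp w c = sp w (s ++ c) by rewrite sp_cat sw ?dwalkW.
have W1 : dwalk w (s ++ c) by rewrite dwalk_cat Ws sw.
rewrite {}E1; case: (sp'_sp_case (dwalkW Wc) (dwalkW W1)) => [[_ [r E1]]|[_ [r E1]]|->].
- rewrite E1 in W1 *; have /andP[_ Wr] : dwalk w c && dwalk (walk_end w c) r.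
    by rewrite -dwalk_cat.
  rewrite cw in Wr.
  rewrite sp'_sp_prefix ?dwalkW // cw; right; exists k, r; split=> //.
  + by rewrite -{1}cw -walk_end_cat -E1 walk_end_cat sw cw.
  + have /eqP := congr1 size E1; rewrite !size_cat addnC eqn_add2l => /eqP sr.
    by rewrite -size_eq0 -sr size_eq0.
- exfalso; have := congr1 size E1; rewrite !size_cat; move: s0.
  by rewrite -size_eq0; move: (size s) (size c) (size r) => i j m; lia.
- by left; rewrite scaler0.
Qed.

Lemma loop_comb_conj w c n x : dwalk w c -> walk_end w c = w ->
  loop_comb w n x -> loop_comb w n (sp' w c * x * sp w c).
Proof.
move=> Wc cw; elim: n x => [|n IH] x /= => [->|[y [z [cy tz ->]]]].
  by rewrite mulr0 mul0r.
exists (sp' w c * y * sp w c), (sp' w c * z * sp w c).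
by split; [apply: IH | apply: loop_term_conj | rewrite mulrDr mulrDl].
Qed.

(** If [c] is a closed walk at [w] that is not a prefix of [s ++ c], then c^* s c = 0, whereas the
    scalar multiple of [P w] is preserved and the other terms remain nontrivial loops or vanish.
    Each conjugation thus removes a term, and one of two incomparable closed walks always qualifies
    as [c]. *)
Lemma hit_loop_comb w n x (k : K) : w \in C -> k != 0 -> loop_comb w n x ->
  hit (k *: P w + x).
Proof.
move=> wC k0; have wU : w \in U by move/fsubsetP: CU; apply.
elim: n x => [|n IH] x /= => [->|[y [z [cy tz ->]]]].
  rewrite addr0.
  have UP : alg inU (P w) by apply: (@sp_alg w [::]).
  exists (k^-1 *: P w), (P w), w; split=> //; first exact: kspanZ.
  by rewrite -scalerAr -!scalerAl !PP scalerA mulfV // scale1r.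
case: tz => [->|[l [s [Ws sw s0 ->]]]]; first by rewrite addr0; apply: IH.
have [c1 [c2 [W1 W2 e1 e2 /andP[p12 p21]]]] := forkC wC.
have [c [Wc cw pc]] : exists c, [/\ dwalk w c, walk_end w c = w & ~~ prefix c (s ++ c)].
  have [q1|q1] := boolP (prefix c1 (s ++ c1)); last by exists c1.
  have [q2|q2] := boolP (prefix c2 (s ++ c2)); last by exists c2.
  have := prefix_shift_comparable s0 q1 q2.
  by rewrite (negbTE p12) (negbTE p21).
apply: (@hitM _ (sp' w c) (sp w c)); first by apply: sp'_alg; rewrite ?cw.
  by apply: sp_alg; rewrite ?cw.
have -> : sp' w c * (k *: P w + (y + l *: sp w s)) * sp w c =
    k *: P w + sp' w c * y * sp w c.
  rewrite !mulrDr !mulrDl -!scalerAr -!scalerAl sp'_P ?dwalkW //.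
  rewrite sp'_sp ?dwalkW // cw -(mulrA _ (sp w s)).
  have -> : sp w s * sp w c = sp w (s ++ c) by rewrite sp_cat sw ?dwalkW.
  rewrite sp'_sp_incomp ?scaler0 ?addr0 //.
    by rewrite dwalk_cat Ws sw.
  apply/negP=> /size_prefix; rewrite size_cat -{2}[size c]add0n leq_add2r.
  by rewrite leqn0 size_eq0 (negbTE s0).
by apply: IH; apply: loop_comb_conj.
Qed.

Definition path_poly (l : seq (K * (vertex E * seq (edge E)))) : T :=
  \sum_(x <- l) x.1 *: sp x.2.1 x.2.2.

Definition pathC (p : vertex E * seq (edge E)) : bool :=
  dwalk p.1 p.2 && (walk_end p.1 p.2 \in C).

(** Let [p] be a shortest walk of the list, ending at [w]. Multiplying by its ghost on the left and
    by [P w] on the right turns [p] into [P w] and every other walk into 0 or a nontrivial loop at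
    [w], so [hit_loop_comb] applies. *)
Lemma path_poly_hit l : all (fun x => pathC x.2) l ->
  path_poly l = 0 \/ hit (path_poly l).
Proof.
have [n] := ubnP (size l); elim: n l => // n IH l ln lC.
case: (posnP (size l)) => [/size0nil ->|l0].
  by left; rewrite /path_poly big_nil.
have [p pl pmin] : exists2 p, p \in map snd l &
    forall p', p' \in map snd l -> (size p.2 <= size p'.2)%N.
  have ex : exists m, has (fun p => size p.2 == m) (map snd l).
    case: l l0 {ln lC} => [//|x l _]; exists (size x.2.2).
    by rewrite /= eqxx.
  case: (ex_minnP ex) => m /hasP[p pl /eqP pm] mmin; exists p => // p' p'l.
  by rewrite pm; apply: mmin; apply/hasP; exists p'.
have [Wp pC] : dwalk p.1 p.2 /\ walk_end p.1 p.2 \in C.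
  by case/mapP: pl => x xl ->; apply/andP; apply: (allP lC).
(* A walk may occur several times in the list. If its coefficients cancel, all its occurrences are
   dropped. *)
pose k := \sum_(x <- l | x.2 == p) x.1.
pose l' := filter (fun x => x.2 != p) l.
have lE : path_poly l = k *: sp p.1 p.2 + path_poly l'.
  rewrite /path_poly (bigID (fun x => x.2 == p)) /= big_filter; congr (_ + _).
  by rewrite /k scaler_suml; apply: eq_bigr => x /eqP ->.
have l'C : all (fun x => pathC x.2) l'.
  by apply/allP => x; rewrite mem_filter => /andP[_ xl]; apply: (allP lC).
have [k0|k0] := eqVneq k 0.
  rewrite lE k0 scale0r add0r; apply: IH => //.
  have [x xl px] : exists2 x, x \in l & x.2 == p.
    by case/mapP: pl => x xl ->; exists x.
  have : (0 < count (predC (fun x => x.2 != p)) l)%N.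
    by rewrite -has_count; apply/hasP; exists x => //=; rewrite px.
  move: ln; rewrite size_filter -(count_predC (fun x => x.2 != p) l).
  by move: (count _ l) (count _ l) => i j; lia.
right; set w := walk_end p.1 p.2 in pC.
have wU : w \in U by move/fsubsetP: CU; apply.
apply: (@hitM _ (sp' p.1 p.2) (P w)); first exact: sp'_alg.
  exact: (@sp_alg w [::]).
have -> : sp' p.1 p.2 * path_poly l * P w =
    k *: P w + sp' p.1 p.2 * path_poly l' * P w.
  rewrite lE mulrDr mulrDl -scalerAr -scalerAl sp'_sp ?dwalkW //.
  by rewrite PP.
apply: (hit_loop_comb (n := size l')) => //.
have : all (fun x => x.2 != p) l' by apply: filter_all.
have : all (fun x => size p.2 <= size x.2.2)%N l'.
  apply/allP => x; rewrite mem_filter => /andP[_ xl].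
  by apply: pmin; apply: map_f.
elim: l' l'C {lE} => [_|x l' IHl /= /andP[/andP[Wx xC] l'C]] => [_ _|].
  by rewrite /path_poly big_nil mulr0 mul0r.
case/andP=> szx l'sz /andP[xp l'p].
exists (sp' p.1 p.2 * path_poly l' * P w),
  (sp' p.1 p.2 * (x.1 *: sp x.2.1 x.2.2) * P w).
split; [exact: IHl | | by rewrite /path_poly big_cons addrC mulrDr mulrDl].
rewrite -scalerAr -scalerAl.
have [xw|xw] := eqVneq (walk_end x.2.1 x.2.2) w; last first.
  by left; rewrite -(sp_P x.2.1) -!mulrA PPn // !mulr0 scaler0.
have -> : sp' p.1 p.2 * sp x.2.1 x.2.2 * P w = sp' p.1 p.2 * sp x.2.1 x.2.2.
  by rewrite -xw -mulrA sp_P.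
case: (sp'_sp_case (dwalkW Wp) (dwalkW Wx)) => [[vE [r E1]]|[vE [r E1]]|->].
- right; exists x.1, r.
  rewrite -vE E1 in Wx xw *.
  have /andP[_ Wr] : dwalk p.1 p.2 && dwalk w r by rewrite -dwalk_cat.
  split=> //; first by rewrite -[RHS]xw walk_end_cat.
    apply: contraNneq xp => r0; apply/eqP.
    by rewrite (surjective_pairing x.2) -vE E1 r0 cats0 -surjective_pairing.
  by rewrite sp'_sp_prefix ?dwalkW.
- case: r E1 => [|f r] E1; last first.
    by move: szx; rewrite E1 size_cat -{2}[size x.2.2]addn0 leq_add2l.
  case/eqP: xp; rewrite cats0 in E1.
  by rewrite (surjective_pairing p) vE E1 -surjective_pairing.
- by left; rewrite scaler0.
Qed.

Inductive mono_le n : T -> Prop :=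
  MonoLe v s w t : dwalk v s -> dwalk w t -> walk_end v s = walk_end w t ->
    walk_end v s \in C -> (size t <= n)%N -> mono_le n (sp v s * sp' w t).

Lemma mono_le0_poly x : kspan (mono_le 0) x ->
  exists2 l, all (fun y => pathC y.2) l & x = path_poly l.
Proof.
elim=> [|{}x y _ [l lC ->] _ [m mC ->]|a {}x _ [l lC ->]|_ [v s w t Ws Wt st eC]].
- by exists [::]; rewrite // /path_poly big_nil.
- exists (l ++ m); first by rewrite all_cat lC mC.
  by rewrite /path_poly big_cat.
- exists (map (fun y => (a * y.1, y.2)) l); first by rewrite all_map.
  rewrite /path_poly scaler_sumr big_map; apply: eq_bigr => y _.
  by rewrite scalerA.
rewrite leqn0 size_eq0 => /eqP t0; subst t.
exists [:: (1, (v, s))]; first by rewrite /= /pathC /= Ws eC.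
by rewrite /path_poly big_seq1 scale1r /= -[w]/(walk_end w [::]) -st sp_P.
Qed.

Lemma J_S' x e : e \in De -> J x -> J (x * S' e).
Proof.
move=> eD; elim=> [|{}x y _ IH _ IH'|a {}x _ IH|_ [v s w t Ws Wt st eC]].
- by rewrite mul0r; apply: kspan0.
- by rewrite mulrDl; apply: kspanD.
- by rewrite -scalerAl; apply: kspanZ.
have [we|we] := eqVneq w (rng e); last first.
  rewrite -(sp'_P (dwalkW Wt)) -(cohn_PS' coh) -!mulrA (mulrA (P w)) PPn //.
  by rewrite mul0r !mulr0; apply: kspan0.
subst w; rewrite -mulrA -/(sp' (src e) (e :: t)).
apply: kspan_gen; constructor=> //.
by move: Wt; rewrite /dwalk /= eqxx eD.
Qed.

Lemma mono_le_S n x e : e \in De -> rng e \in U ->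
  kspan (mono_le n.+1) x -> kspan (mono_le n) (x * S e).
Proof.
move=> eD eU; elim=> [|{}x y _ IH _ IH'|a {}x _ IH|_ [v s w t Ws Wt st eC]].
- by rewrite mul0r; apply: kspan0.
- by rewrite mulrDl; apply: kspanD.
- by rewrite -scalerAl; apply: kspanZ.
case: t Wt st => [|f t] Wt st /= szt.
  have [we|we] := eqVneq w (src e); last first.
    by rewrite -(cohn_PS coh) -mulrA (mulrA (P w)) PPn // mul0r mulr0; apply: kspan0.
  subst w; rewrite -mulrA (cohn_PS coh).
  have eC' : rng e \in C.
    by apply: termC => //; rewrite -[src e]/(walk_end (src e) [::]) -st.
  have We : dwalk (walk_end v s) [:: e] by rewrite st /dwalk /= eqxx eD.
  have -> : sp v s * S e = sp v (s ++ [:: e]) * sp' (rng e) [::].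
    by rewrite sp_cat ?dwalkW //= (cohn_SP coh) -mulrA (cohn_SP coh).
  by apply: kspan_gen; constructor; rewrite ?walk_end_cat // dwalk_cat Ws.
rewrite -!mulrA (cohn_S'S coh); case: eqP => [fe|_]; last first.
  by rewrite !mulr0; apply: kspan0.
subst f; have [_ _ Wt'] := dwalk_consE Wt.
by rewrite sp'_P ?dwalkW //; apply: kspan_gen; constructor.
Qed.

(** A nonempty ghost part starting its product with f^* absorbs the sum exactly, since f^* e = 0 for
    e other than f. Only a monomial without ghost edges feels the defect [out]. *)
Lemma mono_le_CK2 n x : kspan (mono_le n) x ->
  J (x - \sum_(e <- De | rng e \in U) x * S e * S' e).
Proof.
elim=> [|{}x y _ IH _ IH'|a {}x _ IH|_ [v s w t Ws Wt st eC szt]].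
- by rewrite big1 ?subr0 => [|e _]; rewrite ?mul0r //; apply: kspan0.
- under eq_bigr => e _ do rewrite !mulrDl.
  by rewrite big_split /= opprD addrACA; apply: kspanD.
- under eq_bigr => e _ do rewrite -!scalerAl.
  by rewrite -scaler_sumr -scalerBr; apply: kspanZ.
case: t Wt st szt => [|f t] Wt st _ /=.
  have wC : w \in C by rewrite -[w]/(walk_end w [::]) -st.
  have -> : \sum_(e <- De | rng e \in U) sp v s * P w * S e * S' e
          = sp v s * into w.
    rewrite /into mulr_sumr big_seq_cond [RHS]big_seq_cond.
    rewrite (bigID (fun e => src e == w)) /= [X in _ + X]big1 => [|e].
      rewrite addr0; apply: eq_big => [e|e /andP[_ /eqP <-]].
        have [eD|//] := boolP (e \in De); rewrite /= andbC.
        case: eqP => //= ew; apply/idP/idP => [rU|].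
          by apply: termC => //; rewrite ew.
        by move/fsubsetP: CU; apply.
      by rewrite -(mulrA (sp v s)) (cohn_PS coh) -mulrA.
    case/andP=> _ we; rewrite -(cohn_PS coh) -!mulrA (mulrA (P w)) PPn 1?eq_sym //.
    by rewrite mul0r !mulr0.
  have -> : sp v s * P w - sp v s * into w = sp v s * out (walk_end v s) * sp' w [::].
    rewrite st /= -/(walk_end w [::]) /out mulrBr mulrBl -!mulrA PP.
    by rewrite into_P.
  by apply: kspan_gen; constructor.
have [_ fD Wt'] := dwalk_consE Wt.
have fU : rng f \in U.
  apply: (@reach_predU _ (walk_end (rng f) t)); first by exists t.
  by move/fsubsetP: CU; apply; move: eC; rewrite st.
rewrite big_mkcond (big_fsetD1 f) //= fU -!mulrA (mulrA (S' f)) (cohn_S'S coh).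
rewrite eqxx (cohn_PS' coh) big1_fset ?addr0 ?subrr; first exact: kspan0.
move=> e; rewrite !inE => /andP[/negbTE ef _] _; case: ifP => // _.
by rewrite -!mulrA (mulrA (S' f)) (cohn_S'S coh) eq_sym ef !(mul0r, mulr0).
Qed.

(** Modulo [J], [x] is the sum of the (x e) e^*, and the factors x e have shorter ghost parts. If
    none of them hits a vertex, all lie in [J] by induction, and so does [x]. *)
Lemma J_or_hit n x : kspan (mono_le n) x -> J x \/ hit x.
Proof.
elim: n x => [|n IH] x xn.
  have [l lC xE] := mono_le0_poly xn; rewrite xE.
  by have [->|] := path_poly_hit lC; [left; apply: kspan0 | right].
have [[e eD [eU he]]|nohit] :=
    pselect (exists2 e, e \in De & rng e \in U /\ hit (x * S e)).
  right; apply: (@hitM x 1 (S e)); [exact: alg1 | exact: S_alg | by rewrite mul1r].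
left; rewrite -(subrK (\sum_(e <- De | rng e \in U) x * S e * S' e) x).
apply: kspanD; first exact: mono_le_CK2 xn.
rewrite big_seq_cond; apply: kspan_sum => e /andP[eD eU]; apply: J_S' => //.
have [//|he] := IH _ (mono_le_S eD eU xn).
by case: nohit; exists e.
Qed.

Lemma idl_mono_le x : idl inC x -> exists n, kspan (mono_le n) x.
Proof.
elim=> [|{}x y _ [n xn] _ [m ym]|a {}x _ [n xn]|_ [v s w t Ws Wt st eC]].
- by exists 0; apply: kspan0.
- exists (n + m)%N; apply: kspanD.
    apply: kspan_sub xn => _ [v s w t Ws Wt st eC szt]; apply: kspan_gen.
    by constructor=> //; apply: leq_trans szt (leq_addr _ _).
  apply: kspan_sub ym => _ [v s w t Ws Wt st eC szt]; apply: kspan_gen.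
  by constructor=> //; apply: leq_trans szt (leq_addl _ _).
- by exists n; apply: kspanZ.
by exists (size t); apply: kspan_gen; constructor.
Qed.

End PurelyInfinite.

Lemma J_suitable a : idl inC a -> J (a - a * a) -> suitable (alg inU) a.
Proof.
move=> Ca /J_regular[z Jz zE]; apply: suitable_regular zE.
- exact: alg_subring.
- exact: idlC_algU.
- by apply: idlC_algU; apply: J_idl.
Qed.

(** No edge remains in [C], so nothing is subtracted in [out] and the ideal is all of [J]. *)
Lemma acyclic_J x : (forall e, e \in De -> src e \in C -> rng e \notin C) ->
  idl inC x -> J x.
Proof.
move=> acyc; apply: kspan_sub => _ [v s w t Ws Wt st eC].
have outE : out (walk_end v s) = P (walk_end v s).
  rewrite /out /into big_seq_cond big1 ?subr0 // => e /and3P[eD /eqP ev rC].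
  by have := acyc _ eD; rewrite ev rC => /(_ eC).
by rewrite -(sp_P v s) -outE; apply: kspan_gen; constructor.
Qed.

Lemma suitable_component :
  (forall e, e \in De -> src e \in C -> rng e \notin C) \/
  (forall v w, v \in C -> w \in C -> reach v w) /\
  (forall w, w \in C -> exists c1 c2,
    [/\ dwalk w c1, dwalk w c2, walk_end w c1 = w, walk_end w c2 = w
      & ~~ prefix c1 c2 && ~~ prefix c2 c1]) ->
  (forall a, alg inU' a -> suitable (alg inU') a) ->
  forall a, alg inU a -> suitable (alg inU) a.
Proof.
move=> alt IH; apply: suitable_lift => //; apply: suitable_reduce.
move=> a k Ca Ck kk ka ak.
have Cd : idl inC (a - a * a).
  by apply: kspanB => //; apply: idl_mulr => //; apply: idlC_algU.
case: alt => [acyc|[conn fork]]; first by apply: J_suitable => //; apply: acyclic_J.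
have [n dn] := idl_mono_le Cd.
have [/J_suitable|] := J_or_hit fork dn; first by apply.
exact: (suitable_hit conn fork Ca Ck kk ka ak).
Qed.

End Component.

(** What Condition (K) becomes inside a finite set of edges. The fork may lie anywhere in the
    strongly connected component of [v], which is enough because a walk leads from [v] to it and
    both branches lead back. *)
Definition branching : Prop := forall v s, dwalk v s -> s != [::] ->
  walk_end v s = v -> exists e f, [/\ e != f, e \in De /\ f \in De,
    src e = src f, reach v (src e) & reach (rng e) v /\ reach (rng f) v].

Lemma suitable_scalar (c : K) A : suitable (alg A) (c *: 1).
Proof.
have [->|c0] := eqVneq c 0.
  exists 0, 0, 1; rewrite scale0r !mul0r subr0 !mulr1; split=> //.
    exact: kspan0.
  exact: alg1.
exists 1, (c^-1 *: 1), 0; split.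
- by apply: kspanZ; apply: alg1.
- exact: kspan0.
- by rewrite mulr1.
- by rewrite -scalerAl mul1r scalerA mulfV // scale1r.
- by rewrite subrr mulr0.
Qed.

Lemma fork_incomparable (r s t : seq (edge E)) e f : e != f ->
  ~~ prefix (r ++ e :: s) (r ++ f :: t).
Proof.
by move=> ef; elim: r => [|g r IH] /=; rewrite ?(negbTE ef) // eqxx.
Qed.

Lemma suitable_predclosed (U : {fset vertex E}) : branching ->
  (forall e, e \in De -> rng e \in U -> src e \in U) ->
  forall a, alg (fun v => v \in U) a -> suitable (alg (fun v => v \in U)) a.
Proof.
move=> br; have [n] := ubnP #|` U|; elim: n U => // n IH U Un predU.
have [->|[v0 v0U]] := fset_0Vmem U.
  suff scal a : alg (fun v => v \in fset0) a -> exists c : K, a = c *: 1.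
    by move=> a /scal[c ->]; apply: suitable_scalar.
  elim=> [|x y _ [c ->] _ [d ->]|c x _ [d ->]|x [->|[v s w t _ _ _]]].
  - by exists 0; rewrite scale0r.
  - by exists (c + d); rewrite scalerDl.
  - by exists (c * d); rewrite scalerA.
  - by exists 1; rewrite scale1r.
  - by rewrite inE.
pose R v := [fset w in U | `[< reach v w >]]%fset.
have RP v w : reflect (w \in U /\ reach v w) (w \in R v).
  by rewrite !inE; apply: (iffP andP) => -[wU /asboolP].
(* A vertex with the fewest reachable vertices: anything it reaches has the same reachable set, so
   [R v] is strongly connected and terminal in [U]. *)
have [v vU vmin] : exists2 v, v \in U & forall w, w \in U -> (#|` R v| <= #|` R w|)%N.
  have ex : exists m, `[< exists2 v, v \in U & #|` R v| = m >].
    by exists #|` R v0|; apply/asboolP; exists v0.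
  case: (ex_minnP ex) => m /asboolP[v vU vm] mmin; exists v => // w wU.
  by rewrite vm; apply: mmin; apply/asboolP; exists w.
have CU : (R v `<=` U)%fset by apply/fsubsetP => w /RP[].
have back w : w \in R v -> reach w v.
  move=> /RP[wU vw]; suff /RP[] : v \in R w by [].
  suff -> : R w = R v by apply/RP; split=> //; apply: reach_refl.
  apply/eqP; rewrite eqEfcard vmin // andbT; apply/fsubsetP => u /RP[uU wu].
  by apply/RP; split=> //; apply: reach_trans vw wu.
have conn u w : u \in R v -> w \in R v -> reach u w.
  by move=> /back uv /RP[_ vw]; apply: reach_trans uv vw.
have vC : v \in R v by apply/RP; split=> //; apply: reach_refl.
have termC e : e \in De -> src e \in R v -> rng e \in U -> rng e \in R v.
  move=> eD /RP[_ vs] rU; apply/RP; split=> //.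
  exact: reach_trans vs (reach_edge eD).
apply: (suitable_component CU predU termC).
  have [[e eD [sC rC]]|acyc] :=
      pselect (exists2 e, e \in De & src e \in R v /\ rng e \in R v); last first.
    by left=> e eD sC; apply/negP => rC; apply: acyc; exists e.
  right; split=> // w wC.
  have [s Ws sE] := conn _ _ wC sC; have [t Wt tE] := conn _ _ rC wC.
  have W1 : dwalk w (s ++ e :: t).
    by rewrite dwalk_cat Ws sE; move: Wt; rewrite /dwalk /= eqxx eD.
  have [||e1 [e2 [e12 [D1 D2] s12 [r Wr rE] [[r1 Wr1 r1E] [r2 Wr2 r2E]]]]] := br _ _ W1.
  - by case: (s).
  - by rewrite walk_end_cat.
  exists (r ++ e1 :: r1), (r ++ e2 :: r2); split.
  - by rewrite dwalk_cat Wr rE; move: Wr1; rewrite /dwalk /= eqxx D1.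
  - by rewrite dwalk_cat Wr rE s12; move: Wr2; rewrite /dwalk /= eqxx D2.
  - by rewrite walk_end_cat.
  - by rewrite walk_end_cat.
  by rewrite !fork_incomparable // eq_sym.
have -> : (fun u => is_true ((u \in U) && (u \notin R v))) =
    (fun u => is_true (u \in U `\` R v)%fset).
  by apply: funext => u; rewrite in_fsetD andbC.
apply: IH => [|e eD].
  rewrite ltnS in Un; apply: leq_trans Un; apply: fproper_ltn_card.
  rewrite fproperE fsubsetDl /=; apply/fsubsetPn; exists v => //.
  by rewrite in_fsetD vC.
rewrite !in_fsetD => /andP[rC rU]; rewrite predU // andbT.
by apply: contra rC => sC; apply: termC.
Qed.

End Cohn.

(** * Condition (K) *)

Definition mkpath (E : digraph) (v : vertex E) s (W : is_walk v s) : gpath E :=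
  exist _ (v, s) W.

Section ConditionK.
Variable E : digraph.
Implicit Types (v w : vertex E) (s t : seq (edge E)).

Lemma common_prefix s t : exists r s' t',
  [/\ s = r ++ s', t = r ++ t' &
    s' = [::] \/ t' = [::] \/
    exists e f s1 t1, [/\ e != f, s' = e :: s1 & t' = f :: t1]].
Proof.
elim: s t => [|e s IH] t; first by exists [::], [::], t; split=> //; left.
case: t => [|f t]; first by exists [::], (e :: s), [::]; split=> //; right; left.
have [->|ef] := eqVneq e f; last first.
  exists [::], (e :: s), (f :: t); split=> //; right; right.
  by exists e, f, s, t.
have [r [s' [t' [-> -> st]]]] := IH t.
by exists (f :: r), s', t'.
Qed.

Definition simple_loop v s := [/\ is_walk v s, walk_end v s = v, s != [::]
  & forall e, e \in behead s -> src e != v].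

(** A shortest closed walk at [v] is simple, since a return to [v] in between would cut off a
    shorter one. *)
Lemma simple_loop_exists v s : is_walk v s -> walk_end v s = v -> s != [::] ->
  exists t, simple_loop v t.
Proof.
move=> Ws sv s0.
have ex : exists n, `[< exists t,
    [/\ is_walk v t, walk_end v t = v, t != [::] & size t = n] >].
  by exists (size s); apply/asboolP; exists s.
case: (ex_minnP ex) => n /asboolP[t [Wt tv t0 tn]] nmin.
exists t; split=> // e et; apply/eqP => ev.
case: t Wt tv t0 tn et => // f t Wt tv _ tn /= et.
have [t1 [t2 tE]] : exists t1 t2, t = t1 ++ e :: t2.
  by case/splitPr: et => t1 t2; exists t1, t2.
move: Wt; rewrite tE -cat_cons is_walk_cat => /andP[W1 /= /andP[/eqP e1 _]].
have := nmin (size (f :: t1)); rewrite -tn tE /= size_cat /= => H.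
suff : (size t1 < size t1)%N by rewrite ltnn.
apply: leq_trans (_ : (size t1 + (size t2).+1 <= _)%N); last first.
  rewrite -ltnS; apply: H; apply/asboolP; exists (f :: t1); split=> //.
  by rewrite -[LHS]e1 ev.
by rewrite -addSnnS leq_addr.
Qed.

Lemma simple_loopP v s (Ws : is_walk v s) : simple_loop v s <->
  simple_closed_path (mkpath Ws) /\ path_src (mkpath Ws) = v.
Proof.
split=> [[_ sv s0 sb]|[[[s0 sv] sb] _]]; last first.
  split=> //; first exact/eqP.
  by move=> e /sb /eqP.
by split=> //; split; [split=> //; apply/eqP | move=> e /sb /eqP].
Qed.

Lemma simple_loop_prefix v s t : simple_loop v s -> simple_loop v (s ++ t) ->
  t = [::].
Proof.
case=> Ws sv s0 _ [+ _ _]; rewrite is_walk_cat sv => /andP[_].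
case: t => // e t /= /andP[/eqP ev _] /(_ e).
case: s s0 {Ws sv} => //= f s _; rewrite mem_cat mem_head orbT => /(_ isT).
by rewrite ev eqxx.
Qed.

(** Condition (K) yields two distinct simple loops at [v]. Neither extends the other, because the
    longer one would return to [v] too early, so they part at some edge. *)
Lemma conditionK_fork v s : conditionK E ->
  is_walk v s -> walk_end v s = v -> s != [::] ->
  exists r e f t1 t2, [/\ e != f,
    is_walk v (r ++ e :: t1), walk_end v (r ++ e :: t1) = v,
    is_walk v (r ++ f :: t2) & walk_end v (r ++ f :: t2) = v].
Proof.
move=> CK Ws sv s0; have [p sp] := simple_loop_exists Ws sv s0.
have [q sq pq] : exists2 q, simple_loop v q & p != q.
  apply/not_exists2P => nq; apply: (CK v); have [Wp _ _ _] := sp.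
  exists (mkpath Wp); split; first exact/simple_loopP.
  case=> -[w q] /= Wq [sc wv]; rewrite /path_src /= in wv; subst w.
  apply: val_inj; congr (_, _) => /=; apply/eqP/negPn/negP => pq.
  have /simple_loopP sq := conj sc (erefl : path_src (mkpath Wq) = v).
  by case: (nq q).
have [r [p' [q' [pE qE [p0|[q0|]]]]]] := common_prefix p q.
- rewrite p0 cats0 in pE; subst r; rewrite qE in sq.
  by case/eqP: pq; rewrite qE (simple_loop_prefix sp sq) cats0.
- rewrite q0 cats0 in qE; subst r; rewrite pE in sp.
  by case/eqP: pq; rewrite pE (simple_loop_prefix sq sp) cats0.
case=> [e [f [t1 [t2 [ef p'E q'E]]]]]; exists r, e, f, t1, t2.
by move: sp sq; rewrite pE qE p'E q'E => -[Wp pv _ _] [Wq qv _ _].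
Qed.

Lemma closed_dwalk_reach (De : {fset edge E}) v s h : dwalk De v s ->
  walk_end v s = v -> h \in s ->
  [/\ h \in De, reach De v (src h) & reach De (src h) v].
Proof.
move=> Ws sv hs; case/splitPr: hs Ws sv => s1 s2 Ws sv.
move: (Ws); rewrite dwalk_cat => /andP[W1 W2].
have [E1 hD _] := dwalk_consE W2.
rewrite E1; split=> //; first by exists s1.
by rewrite -E1; exists (h :: s2); rewrite ?E1 // -[RHS]sv walk_end_cat.
Qed.

Lemma dwalk_sub (D D' : {fset edge E}) v s : {subset D <= D'} ->
  dwalk D v s -> dwalk D' v s.
Proof. by move=> DD' /andP[Ws /sub_all Ds]; rewrite /dwalk Ws Ds. Qed.

Lemma reach_sub (D D' : {fset edge E}) v w : {subset D <= D'} ->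
  reach D v w -> reach D' v w.
Proof. by move=> DD' [s Ws sw]; exists s => //; apply: dwalk_sub Ws. Qed.

(** For each edge [g] of [G] on a cycle, two closed walks at [src g] that fork are added. One round
    suffices: every added edge lies on a closed walk at some [src g], so any closed walk of the
    enlarged graph is strongly connected to a vertex that already has its fork. *)
Lemma branching_closure (G : {fset edge E}) : conditionK E ->
  exists2 De : {fset edge E}, (G `<=` De)%fset & branching De.
Proof.
move=> CK.
pose cyc g := exists s, is_walk (rng g) s /\ walk_end (rng g) s = src g.
have HW0 g : exists Wg : {fset edge E}, cyc g ->
    [/\ exists e f, [/\ e != f, e \in Wg /\ f \in Wg, src e = src f,
          reach Wg (src g) (src e)
        & reach Wg (rng e) (src g) /\ reach Wg (rng f) (src g)]
      & forall h, h \in Wg -> reach Wg (src g) (src h) /\ reach Wg (src h) (src g)].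
  have [[s [Ws sg]]|ncyc] := pselect (cyc g); last by exists fset0.
  have [||//|r [e [f [t1 [t2 [ef W1 e1 W2 e2]]]]]] :=
      @conditionK_fork (src g) (g :: s) CK.
  - by rewrite /= eqxx.
  - exact: sg.
  pose D := [fset x in (r ++ e :: t1) ++ (r ++ f :: t2)]%fset.
  have D1 : dwalk D (src g) (r ++ e :: t1).
    by rewrite /dwalk W1; apply/allP => x xs; rewrite in_fset /= mem_cat xs.
  have D2 : dwalk D (src g) (r ++ f :: t2).
    by rewrite /dwalk W2; apply/allP => x xs; rewrite in_fset /= mem_cat xs orbT.
  exists D => _; split=> [|h]; last first.
    rewrite in_fset /= mem_cat => /orP[] hs.
      by have [] := closed_dwalk_reach D1 e1 hs.
    by have [] := closed_dwalk_reach D2 e2 hs.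
  move: D1 D2 e1 e2; rewrite !dwalk_cat !walk_end_cat => /andP[Dr D1] /andP[_ D2] e1 e2.
  have [s1 eD Wt1] := dwalk_consE D1; have [s2 fD Wt2] := dwalk_consE D2.
  exists e, f; split=> //; first by rewrite s1 s2.
    by exists r.
  by split; [exists t1 | exists t2].
have [W HW] := choice HW0.
pose De := (G `|` \bigcup_(g <- [seq g <- G | `[< cyc g >]]) W g)%fset.
have WD g : g \in G -> cyc g -> {subset W g <= De}.
  move=> gG cg x xW; rewrite inE; apply/orP; right; apply/bigfcupP.
  by exists g => //; rewrite mem_filter gG !andbT; apply/asboolP.
exists De; first exact: fsubsetUl.
move=> v s Ws s0 sv; case: s Ws s0 sv => // h s /dwalk_consE[hv hD Ws] _ /= sv.
have [g [gG cg vg gv]] : exists g,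
    [/\ g \in G, cyc g, reach De v (src g) & reach De (src g) v].
  move: hD; rewrite inE => /orP[hG|/bigfcupP[g]].
    exists h; split=> //; rewrite ?hv; do ?exact: reach_refl.
    by exists s; split; [case/andP: Ws | rewrite hv].
  rewrite mem_filter andbT => /andP[/asboolP cg gG] hW.
  have [_ /(_ h hW)[gh hg]] := HW g cg; have sub := WD g gG cg.
  by exists g; split=> //; rewrite -hv; apply: reach_sub sub _.
have [[e [f [ef [eW fW] sef ge [eg fg]]]] _] := HW g cg.
have sub := WD g gG cg.
exists e, f; split=> //; first by split; apply: sub.
  exact: reach_trans vg (reach_sub sub ge).
by split; apply: reach_trans gv; [apply: reach_sub eg | apply: reach_sub fg].
Qed.

End ConditionK.

(** * Unitization of [L_K(E)] *)

HB.mixin Record Rng_Lmodule_isRngAlgebra (K : fieldType) L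
    of Rng L & GRing.Lmodule K L := {
  rngscaleAl : forall (a : K) (x y : L), (a *: x) ** y = a *: (x ** y);
  rngscaleAr : forall (a : K) (x y : L), x ** (a *: y) = a *: (x ** y)
}.

#[short(type="rngAlgType")]
HB.structure Definition RngAlgebra (K : fieldType) :=
  {L of Rng L & GRing.Lmodule K L & Rng_Lmodule_isRngAlgebra K L}.

Section Unitization.
Variables (K : fieldType) (L : rngAlgType K).

Definition unitization : Type := (K * L)%type.
HB.instance Definition _ := GRing.Zmodule.on unitization.

Definition unitization_mul (x y : unitization) : unitization :=
  (x.1 * y.1, x.1 *: y.2 + y.1 *: x.2 + x.2 ** y.2).

Definition unitization_scale (a : K) (x : unitization) : unitization :=
  (a * x.1, a *: x.2).

Fact unitization_mulA : associative unitization_mul.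
Proof.
move=> [a x] [b y] [c z]; congr (_, _) => /=; first exact: mulrA.
rewrite !scalerDr !rngmulDl !rngmulDr !scalerA !rngscaleAl !rngscaleAr rngmulA.
rewrite (mulrC c a) (mulrC c b) -!addrA; congr (_ + _); congr (_ + _).
by rewrite addrCA; congr (_ + _); rewrite [X in _ + X = _]addrCA [LHS]addrCA.
Qed.

Fact unitization_mul1l : left_id (1, 0) unitization_mul.
Proof.
by move=> [a x]; congr (_, _); rewrite /= ?mul1r // scale1r scaler0 rngmul0l !addr0.
Qed.

Fact unitization_mul1r : right_id (1, 0) unitization_mul.
Proof.
move=> [a x]; congr (_, _); rewrite /= ?mulr1 //.
by rewrite scale1r scaler0 rngmul0r add0r addr0.
Qed.

Fact unitization_mulDl : left_distributive unitization_mul +%R.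
Proof.
move=> [a x] [b y] [c z]; congr (_, _) => /=; first exact: mulrDl.
rewrite !scalerDr !rngmulDl scalerDl.
by rewrite [X in X + _ = _]addrACA [LHS]addrACA.
Qed.

Fact unitization_mulDr : right_distributive unitization_mul +%R.
Proof.
move=> [a x] [b y] [c z]; congr (_, _) => /=; first exact: mulrDr.
rewrite !scalerDr !rngmulDr scalerDl.
by rewrite [X in X + _ = _]addrACA [LHS]addrACA.
Qed.

Fact unitization_1neq0 : (1, 0) != 0 :> unitization.
Proof. by apply/eqP => -[/eqP]; rewrite oner_eq0. Qed.

HB.instance Definition _ := GRing.Zmodule_isNzRing.Build unitization
  unitization_mulA unitization_mul1l unitization_mul1r
  unitization_mulDl unitization_mulDr unitization_1neq0.

Fact unitization_scaleA a b x :
  unitization_scale a (unitization_scale b x) = unitization_scale (a * b) x.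
Proof. by congr (_, _); rewrite /= ?mulrA ?scalerA. Qed.

Fact unitization_scale1 : left_id 1 unitization_scale.
Proof. by move=> [a x]; congr (_, _); rewrite /= ?mul1r ?scale1r. Qed.

Fact unitization_scaleDr : right_distributive unitization_scale +%R.
Proof. by move=> a x y; congr (_, _); rewrite /= ?mulrDr ?scalerDr. Qed.

Fact unitization_scaleDl x : {morph unitization_scale^~ x : a b / a + b}.
Proof. by move=> a b; congr (_, _); rewrite /= ?mulrDl ?scalerDl. Qed.

HB.instance Definition _ := GRing.Zmodule_isLmodule.Build K unitization
  unitization_scaleA unitization_scale1 unitization_scaleDr unitization_scaleDl.

Fact unitization_scaleAl (a : K) (x y : unitization) : a *: (x * y) = a *: x * y.
Proof.
congr (_, _) => /=; first exact: mulrA.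
by rewrite !scalerDr !scalerA rngscaleAl (mulrC a y.1).
Qed.

HB.instance Definition _ :=
  GRing.Lmodule_isLalgebra.Build K unitization unitization_scaleAl.

Fact unitization_scaleAr (a : K) (x y : unitization) : a *: (x * y) = x * (a *: y).
Proof.
congr (_, _) => /=; first exact: mulrCA.
by rewrite !scalerDr !scalerA rngscaleAr (mulrC a x.1).
Qed.

HB.instance Definition _ :=
  GRing.Lalgebra_isAlgebra.Build K unitization unitization_scaleAr.

Definition uinj (x : L) : unitization := (0, x).

Lemma uinjD x y : uinj (x + y) = uinj x + uinj y.
Proof. by apply: injective_projections; rewrite /= ?addr0. Qed.

Lemma uinjN x : uinj (- x) = - uinj x.
Proof. by apply: injective_projections; rewrite /= ?oppr0. Qed.

Lemma uinjM x y : uinj (x ** y) = uinj x * uinj y.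
Proof.
by apply: injective_projections; rewrite /= ?mul0r // !scale0r !add0r.
Qed.

Lemma uinjZ a x : uinj (a *: x) = a *: uinj x.
Proof. by apply: injective_projections; rewrite /= ?mulr0. Qed.

Lemma uinj_inj : injective uinj. Proof. by move=> x y []. Qed.

Lemma uinjP (x : unitization) : x.1 = 0 -> x = uinj x.2.
Proof. by case: x => a x /= ->. Qed.

Lemma suitable_unitization (B : unitization -> Prop) x : suitable B (uinj x) ->
  exists e r s : L, [/\ e ** e = e, e = x ** r & e = x + s - x ** s].
Proof.
case=> e [r [t [_ _ ee er et]]].
have e0 : e = uinj e.2 by apply: uinjP; rewrite er /= mul0r.
(* The witnesses may have a scalar part. [r * e] has none and also gives x (r e) = e e = e, and the
   required s = 1 - t equals [e - x * t], which has none either. *)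
have r0 : r * e = uinj (r * e).2 by apply: uinjP; rewrite e0 /= mulr0.
have s0 : e - uinj x * t = uinj (e - uinj x * t).2.
  by apply: uinjP; rewrite e0 /= mul0r subr0.
move: e.2 (r * e).2 (e - uinj x * t).2 e0 r0 s0 => e' r' s' e0 r0 s0.
exists e', r', s'; split; apply: uinj_inj.
- by rewrite uinjM -e0.
- by rewrite uinjM -r0 -e0 mulrA -er ee.
rewrite !uinjD uinjN uinjM -s0 -e0.
transitivity (e + uinj x * (1 - e - (1 - uinj x) * t)).
  by rewrite et subrr mulr0 addr0.
non_commutative_ring.
Qed.

End Unitization.

(** * The algebra structure of L_K(E) and its vertices, edges and ghosts *)

Section LeavittScale.
Variables (K : fieldType) (E : digraph).
Local Notation KE := (path_algebra K (Defs.double E)).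
Local Notation L := (leavitt_path_algebra K E).
Local Notation bv := (leavitt_vertex K).

Lemma path_mulE (f g : KE) : f ** g = path_mul f g. Proof. by []. Qed.

Lemma path_scaleAl a (f g : KE) : (a *: f) ** g = a *: (f ** g).
Proof. exact: path_mulZl. Qed.

Lemma path_scaleAr a (f g : KE) : f ** (a *: g) = a *: (f ** g).
Proof. exact: path_mulZr. Qed.

Lemma vertex_mul_path (v : vertex E) (p : gpath (Defs.double E)) :
  bv v ** path_elt K p = if v == path_src p then path_elt K p else 0.
Proof.
rewrite path_mulE path_mulUU /basis_mul /path_rng /=.
case: eqP => // vp; congr path_elt; apply: val_inj; rewrite val_path_cat //.
have -> : path_src (vertex_path (E := Defs.double E) v) = path_src p := vp.
by rewrite /path_src /path_edges /=; case: (val p).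
Qed.

Lemma left_unit (f : KE) : exists A : {fset vertex E},
  forall B : {fset vertex E}, (A `<=` B)%fset -> (\sum_(v <- B) bv v) ** f = f.
Proof.
elim/path_algebra_ind: f => [|f g [A fA] [B gB]|a f [A fA]|p].
- by exists fset0 => B _; rewrite rngmul0r.
- exists (A `|` B)%fset => C AB; rewrite rngmulDr fA ?gB //.
    exact: fsubset_trans (fsubsetUr _ _) AB.
  exact: fsubset_trans (fsubsetUl _ _) AB.
- by exists A => B AB; rewrite path_scaleAr fA.
exists [fset (path_src p : vertex E)]%fset => A; rewrite fsub1set => pA.
rewrite rngmul_suml (big_fsetD1 _ pA) /= vertex_mul_path eqxx.
rewrite big1_fset ?addr0 // => v; rewrite !inE => /andP[/negbTE vp _] _.
by rewrite vertex_mul_path vp.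
Qed.

Lemma ideal_scale a (f : KE) :
  ideal_generated (@leavitt_relator K E) f ->
  ideal_generated (@leavitt_relator K E) (a *: f).
Proof.
move=> If; have [A /(_ A (fsubset_refl A)) fA] := left_unit f.
by rewrite -fA -path_scaleAl; apply: is_idealMl (ideal_generatedP _) _ _ If.
Qed.

Definition lpi (f : KE) : L := rng_pi (@leavitt_relator K E) f.

Lemma lpiK (x : L) : lpi (repr x) = x. Proof. exact: rng_piK. Qed.

Lemma lpi_eq f g : lpi f = lpi g <->
  ideal_generated (@leavitt_relator K E) (f - g).
Proof. exact: rng_pi_eq. Qed.

Lemma lpiD : {morph lpi : f g / f + g}. Proof. exact: rng_piD. Qed.

Lemma lpi0 : lpi 0 = 0.
Proof. by apply: (addrI (lpi 0)); rewrite -lpiD !addr0. Qed.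

Lemma lpiB : {morph lpi : f g / f - g}.
Proof. by move=> f g; apply: (addIr (lpi g)); rewrite -lpiD !subrK. Qed.

Lemma lpiM : {morph lpi : f g / f ** g >-> f ** g}.
Proof. by move=> f g; apply/esym/rng_piM. Qed.

Lemma lpi_surj (x : L) : exists f, x = lpi f.
Proof. by exists (repr x); rewrite lpiK. Qed.

Definition lscale (a : K) (x : L) : L := lpi (a *: repr x).

Lemma lpiZ a f : lpi (a *: f) = lscale a (lpi f).
Proof.
apply/lpi_eq; rewrite -scalerBr; apply: ideal_scale; apply/lpi_eq.
by rewrite lpiK.
Qed.

Lemma lscaleDr a : {morph lscale a : x y / x + y}.
Proof.
move=> x y; have [f ->] := lpi_surj x; have [g ->] := lpi_surj y.
by rewrite -lpiD -!lpiZ scalerDr lpiD.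
Qed.

Lemma lscaleDl x : {morph lscale^~ x : a b / a + b}.
Proof. by move=> a b; have [f ->] := lpi_surj x; rewrite -!lpiZ scalerDl lpiD. Qed.

Lemma lscaleA a b x : lscale a (lscale b x) = lscale (a * b) x.
Proof. by have [f ->] := lpi_surj x; rewrite -!lpiZ scalerA. Qed.

Lemma lscale1 x : lscale 1 x = x.
Proof. by have [f ->] := lpi_surj x; rewrite -lpiZ scale1r. Qed.

Lemma lscaleMl a x y : lscale a x ** y = lscale a (x ** y).
Proof.
have [f ->] := lpi_surj x; have [g ->] := lpi_surj y.
by rewrite -lpiM -!lpiZ -lpiM path_scaleAl.
Qed.

Lemma lscaleMr a x y : x ** lscale a y = lscale a (x ** y).
Proof.
have [f ->] := lpi_surj x; have [g ->] := lpi_surj y.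
by rewrite -lpiM -!lpiZ -lpiM path_scaleAr.
Qed.

HB.instance Definition _ := GRing.Zmodule_isLmodule.Build K
  (rng_quot (@leavitt_relator K E)) lscaleA lscale1 lscaleDr lscaleDl.

HB.instance Definition _ := Rng_Lmodule_isRngAlgebra.Build K
  (rng_quot (@leavitt_relator K E)) lscaleMl lscaleMr.

Definition leavitt_alg : rngAlgType K := rng_quot (@leavitt_relator K E).

Local Notation T := (unitization leavitt_alg).

Definition emb (f : KE) : T := uinj (lpi f : leavitt_alg).

Lemma embM f g : emb (f ** g) = emb f * emb g.
Proof. by rewrite /emb lpiM uinjM. Qed.

Lemma embD f g : emb (f + g) = emb f + emb g.
Proof. by rewrite /emb lpiD uinjD. Qed.

Lemma embZ a f : emb (a *: f) = a *: emb f.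
Proof. by rewrite /emb -uinjZ lpiZ. Qed.

Lemma emb0 : emb 0 = 0. Proof. by rewrite /emb lpi0. Qed.

Lemma path_mul_vertex (v : vertex E) (p : gpath (Defs.double E)) :
  path_elt K p ** bv v = if path_rng p == v then path_elt K p else 0.
Proof.
rewrite path_mulE path_mulUU /basis_mul.
have -> : path_src (vertex_path (E := Defs.double E) v) = v by [].
case: eqP => // vp; congr path_elt; apply: val_inj; rewrite val_path_cat //.
by rewrite cats0 /path_src /path_edges; case: (val p).
Qed.

Lemma lpi_relator f : leavitt_relator f -> lpi f = 0.
Proof.
move=> rf; rewrite -lpi0; apply/lpi_eq; rewrite subr0.
by move=> I _; apply.
Qed.

Definition embP v : T := emb (bv v).
Definition embS e : T := emb (leavitt_edge K e).
Definition embS' e : T := emb (leavitt_ghost K e).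

Lemma leavitt_cohn_family : cohn_family embP embS embS'.
Proof.
split=> [v w|e|e|e|e|e f]; rewrite /embP /embS /embS' -embM;
  rewrite ?vertex_mul_path ?path_mul_vertex.
- by case: eqP => [->|vw]; rewrite ?emb0 //; case: eqP.
- by rewrite eqxx.
- by rewrite eqxx.
- by rewrite eqxx.
- by rewrite eqxx.
case: eqP => [<-|ef]; last first.
  by rewrite /emb (lpi_relator (Relator_CK1_neq K ef)).
congr uinj; apply/eqP; rewrite -subr_eq0 -lpiB lpi_relator //.
exact: Relator_CK1.
Qed.

End LeavittScale.

(** * Condition (K) implies the exchange property *)

Section Sufficiency.
Variables (K : fieldType) (E : digraph).
Local Notation KE := (path_algebra K (Defs.double E)).
Local Notation embP := (@embP K E).
Local Notation embS := (@embS K E).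
Local Notation embS' := (@embS' K E).
Local Notation algE De U := (alg embP embS embS' De (fun v => v \in U)).

Definition edge_of (d : edge (Defs.double E)) : edge E :=
  match d with inl e => e | inr e => e end.

Lemma path_elt_cons (v : vertex E) (d : edge (Defs.double E)) s
    (W : is_walk (E := Defs.double E) v (d :: s)) :
  exists W' : is_walk (E := Defs.double E) (rng d) s,
    path_elt K (mkpath W) =
    path_elt K (edge_path d) **
      path_elt K (mkpath W').
Proof.
have /andP[/eqP sd W'] : (src d == v) && is_walk (E := Defs.double E) (rng d) s := W.
exists W'; rewrite path_mulE path_mulUU /basis_mul.
have -> : path_rng (edge_path d) == path_src (mkpath W').
  exact: eqxx.
congr path_elt; apply: val_inj; rewrite val_path_cat //=.
congr (_, _); exact: esym sd.
Qed.

Lemma emb_path_alg (De : {fset edge E}) (U : {fset vertex E})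
    (v : vertex E) s (W : is_walk (E := Defs.double E) v s) :
  (forall d, d \in s -> edge_of d \in De) -> v \in U ->
  (forall e, e \in De -> src e \in U /\ rng e \in U) ->
  algE De U (emb (path_elt K (mkpath W))).
Proof.
have coh := leavitt_cohn_family K E.
move=> + + DU; elim: s v W => [|d s IH] v W sD vU.
  have -> : mkpath W =
      vertex_path (E := Defs.double E) v by apply: val_inj.
  exact: (sp_alg coh (s := [::])).
have [W' ->] := path_elt_cons W.
have dD : edge_of d \in De by apply: sD; rewrite mem_head.
have [sU rU] := DU _ dD.
rewrite embM; apply: (subringM (alg_subring coh _ _)).
  case: d {W W' sD} dD sU rU => e /= eD sU rU; first exact: (S_alg coh eD rU).
  have := sp'_alg coh (De := De) (U := U) (v := src e) (s := [:: e]).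
  by rewrite /= (cohn_PS' coh); apply; rewrite // /dwalk /= eqxx eD.
apply: IH => [d' d's|]; first by apply: sD; rewrite inE d's orbT.
by case: d {W sD W'} dD sU rU.
Qed.

(** Stated for all larger [De] and [U], because [branching_closure] enlarges the edge set after the
    element has been fixed. *)
Lemma emb_alg (f : KE) : exists D0 : {fset edge E}, exists V0 : {fset vertex E},
  forall (De : {fset edge E}) (U : {fset vertex E}),
  {subset D0 <= De} -> {subset V0 <= U} ->
  (forall e, e \in De -> src e \in U /\ rng e \in U) -> algE De U (emb f).
Proof.
elim/path_algebra_ind: f => [|f g [D [V fD]] [D' [V' gD]]|a f [D [V fD]]|p].
- by exists fset0, fset0 => De U _ _ _; rewrite emb0; apply: kspan0.
- exists (D `|` D')%fset, (V `|` V')%fset => De U DD VU DU.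
  rewrite embD; apply: kspanD.
    by apply: fD => // x xD; [apply: DD | apply: VU]; rewrite inE xD.
  by apply: gD => // x xD; [apply: DD | apply: VU]; rewrite inE xD orbT.
- by exists D, V => De U DD VU DU; rewrite embZ; apply: kspanZ; apply: fD.
case: p => -[v s] /= W.
exists (seq_fset tt (map edge_of s)), [fset (v : vertex E)]%fset => De U DD VU DU.
apply: (@emb_path_alg De U v s W) => // [d ds|]; last by apply: VU; rewrite inE.
by apply: DD; rewrite seq_fsetE map_f.
Qed.

Lemma conditionK_exchange : conditionK E ->
  exchange_ring (leavitt_path_algebra K E).
Proof.
move=> CK x; have [f ->] := lpi_surj x.
have [D0 [V0 fD]] := emb_alg f.
have [De DD br] := branching_closure D0 CK.
(* With all endpoints of [De] included, [U] is closed under predecessors. *)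
pose U := (V0 `|` ([fset src e | e in De] `|` [fset rng e | e in De]))%fset.
have DU e : e \in De -> src e \in U /\ rng e \in U.
  by move=> eD; rewrite !inE !in_imfset ?orbT.
apply: (@suitable_unitization K (leavitt_alg K E) (algE De U)).
apply: (suitable_predclosed (leavitt_cohn_family K E) br).
  by move=> e eD _; have [] := DU e eD.
apply: fD => //; first exact/fsubsetP.
by move=> v vV; rewrite inE vV.
Qed.

End Sufficiency.

(** * Necessity of Condition (K) *)

Section Laurent.
Variable K : fieldType.
Local Notation F := {fraction {poly K}}.
Local Notation x := (tofrac 'X : F).

Lemma fracX_neq0 : x != 0.
Proof. by rewrite tofrac_eq0 polyX_eq0. Qed.

Definition laurent (g : F) : Prop := exists n p, g * x ^+ n = tofrac p.

Lemma laurent_poly p : laurent (tofrac p).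
Proof. by exists 0, p; rewrite expr0 mulr1. Qed.

Lemma laurentV : laurent x^-1.
Proof. by exists 1, 1; rewrite expr1 mulVf ?fracX_neq0 // tofrac1. Qed.

Lemma laurentM g h : laurent g -> laurent h -> laurent (g * h).
Proof.
move=> [n [p gp]] [m [q hq]]; exists (n + m)%N, (p * q).
by rewrite exprD mulrACA gp hq tofracM.
Qed.

Lemma laurentD g h : laurent g -> laurent h -> laurent (g + h).
Proof.
move=> [n [p gp]] [m [q hq]]; exists (n + m)%N, (p * 'X^m + q * 'X^n).
rewrite tofracD !tofracM !tofracXn -gp -hq mulrDl exprD.
by rewrite mulrA [x ^+ n * _]mulrC mulrA.
Qed.

(** An inverse would make [q] a divisor of some power of X. But [q] is coprime to X, as 0 is not a
    root, and it is not constant. *)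
Lemma laurent_not_unit (q : {poly K}) g : (1 < size q)%N -> ~~ root q 0 ->
  laurent g -> tofrac q * g <> 1.
Proof.
move=> sq q0 [n [p gp]] qg.
have : q * p = 'X^n.
  apply/eqP; rewrite -tofrac_eq tofracM -gp mulrA qg mul1r tofracXn //.
move=> qp; have qX : q %| 'X^n by rewrite -qp dvdp_mulr.
have cop : coprimep q 'X^n by rewrite coprimep_expr // coprimepX.
have := coprimep_dvdl qX cop.
by rewrite coprimepp => /eqP sq1; rewrite sq1 in sq.
Qed.

(* Both [y = x + x^2] and [1 - y] are non-units of the Laurent polynomial ring,
   for every field [K]. *)
Lemma laurent_not_suitable (f r s : F) : laurent r -> laurent s -> f * f = f ->
  f = (x + x ^+ 2) * r -> f = (x + x ^+ 2) + s - (x + x ^+ 2) * s -> False.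
Proof.
move=> Lr Ls ff fr fs.
have [f0|f1] : f = 0 \/ f = 1.
  have /eqP : f * (f - 1) = 0 by rewrite mulrBr mulr1 ff subrr.
  by rewrite mulf_eq0 subr_eq0 => /orP[/eqP|/eqP]; [left | right].
(* If f = 0, the last equation reads (1 - x - x^2) (1 - s) = 1. If f = 1, the other one reads (1 +
   x) (x r) = 1. *)
- apply: (@laurent_not_unit (1 - 'X - 'X^2) (1 - s)).
  + have -> : 1 - 'X - 'X^2 = - ('X^2 + ('X - 1%:P)) :> {poly K}.
      by rewrite polyC1; ring.
    by rewrite size_polyN size_polyDl size_polyXn // size_XsubC.
  + by rewrite rootE !hornerE ?expr0n ?mulr0 ?subr0 oner_eq0.
  + have -> : 1 - s = tofrac 1 + tofrac (- 1) * s.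
      by rewrite tofrac1 tofracN tofrac1 mulN1r.
    by apply: laurentD; [|apply: laurentM => //]; apply: laurent_poly.
  rewrite !tofracB tofracXn tofrac1; move: fs; rewrite f0 => fs.
  transitivity (1 - ((x + x ^+ 2) + s - (x + x ^+ 2) * s)); first by ring.
  by rewrite -fs subr0.
apply: (@laurent_not_unit ('X + 1) (x * r)).
- by rewrite -polyC1 size_XaddC.
- by rewrite rootE !hornerE ?add0r oner_eq0.
- by apply: laurentM => //; apply: laurent_poly.
by rewrite tofracD tofrac1 -[RHS]f1 fr; ring.
Qed.

End Laurent.

(** * The representation attached to a unique simple loop *)

Section UniqueLoop.
Variables (K : fieldType) (E : digraph) (v0 : vertex E).
Variables (e1 : edge E) (c1 : seq (edge E)).
Hypothesis loop : simple_loop v0 (e1 :: c1).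
Hypothesis uloop : forall s, simple_loop v0 s -> s = e1 :: c1.

Local Notation F := {fraction {poly K}}.
Local Notation x := (tofrac 'X : F).
Local Notation M := (seq (edge E) -> F).

(* Basis of the module: the paths ending at [v0] that avoid [v0] before their
   end; such a path is determined by its edges, [[::]] standing for [v0]. *)
Definition start (s : seq (edge E)) : vertex E := if s is e :: _ then src e else v0.

Definition avoiding (s : seq (edge E)) : bool :=
  [&& is_walk (start s) s, walk_end (start s) s == v0 & all (fun e => src e != v0) s].

Lemma avoiding_nil : avoiding [::]. Proof. by rewrite /avoiding /= eqxx. Qed.

Lemma avoiding_cons e s : avoiding (e :: s) ->
  [/\ avoiding s, start s = rng e & src e != v0].
Proof.
case/and3P=> /= /andP[_ Ws] we /andP[ev sv].
have st : start s = rng e.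
  by case: s Ws we {sv} => [_ /eqP|f s /= /andP[/eqP]].
by rewrite /avoiding st Ws we.
Qed.

Lemma loop_src : src e1 = v0.
Proof. by case: loop => /= /andP[/eqP]. Qed.

Lemma avoiding_c1 : avoiding c1 /\ start c1 = rng e1.
Proof.
case: loop => /= /andP[_ Wc] ec _ nc.
have st : start c1 = rng e1.
  by case: c1 Wc ec {nc} => [_ //|f s /= /andP[/eqP]].
split=> //; rewrite /avoiding st Wc /=; apply/andP; split; first exact/eqP.
by apply/allP => e /nc.
Qed.

Lemma avoiding_loop e s :
  src e = v0 -> avoiding s -> start s = rng e -> e :: s = e1 :: c1.
Proof.
move=> ev /and3P[Ws /eqP se sv] st; apply: uloop; split=> //=.
- by rewrite ev eqxx -st.
- by rewrite -[LHS]/(walk_end (rng e) s) -st.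
- by move=> f fs; apply: (allP sv).
Qed.

Definition opP (w : vertex E) (m : M) : M :=
  fun q => if avoiding q && (start q == w) then m q else 0.

(** Away from [v0] the edge is put in front of the path. At [v0] the closed path [e1 :: c1] is
    identified with [x] times the trivial path, so [e1] sends [c1] there. The other edges leaving
    [v0] act as 0, which is consistent because by uniqueness of the loop no basis path starts at
    their range. *)
Definition opS (e : edge E) (m : M) : M := fun q =>
  if src e == v0 then (if (q == [::]) && (e == e1) then x * m c1 else 0)
  else if avoiding q && (ohead q == Some e) then m (behead q) else 0.

Definition opS' (e : edge E) (m : M) : M := fun q =>
  if src e == v0 then (if (q == c1) && (e == e1) then x^-1 * m [::] else 0)
  else if avoiding (e :: q) then m (e :: q) else 0.

Lemma opPP v w m : opP v (opP w m) = if v == w then opP v m else fun=> 0.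
Proof.
apply: funext => q; have [<-|vw] := eqVneq v w; rewrite /opP.
  by case: (avoiding q) => //=; case: (start q == v).
by case: (avoiding q) => //=; have [->|//] := eqVneq (start q) v; rewrite (negbTE vw).
Qed.

Lemma opPS e m : opP (src e) (opS e m) = opS e m.
Proof.
apply: funext => q; rewrite /opP /opS; case: ifP => // nq.
case: eqP => [ev|_].
  case: ifP => // /andP[/eqP q0 _]; move: nq.
  by rewrite q0 avoiding_nil /= ev eqxx.
case: ifP => // /andP[gq /eqP qe]; move: nq; rewrite gq /=.
by case: q qe {gq} => //= f q [->]; rewrite eqxx.
Qed.

Lemma opSP e m : opS e (opP (rng e) m) = opS e m.
Proof.
have [gc sc] := avoiding_c1.
apply: funext => q; rewrite /opP /opS; case: eqP => [ev|ev].
  by case: ifP => // /andP[_ /eqP ->]; rewrite gc sc eqxx.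
case: ifP => // /andP[gq /eqP qe]; case: q qe gq => //= f q [->] /avoiding_cons[-> -> _].
by rewrite eqxx.
Qed.

Lemma opS'P e m : opS' e (opP (src e) m) = opS' e m.
Proof.
apply: funext => q; rewrite /opP /opS'; case: eqP => [ev|ev].
  by case: ifP => // _; rewrite avoiding_nil /= ev eqxx.
by case: ifP => // -> /=; rewrite eqxx.
Qed.

Lemma opPS' e m : opP (rng e) (opS' e m) = opS' e m.
Proof.
have [gc sc] := avoiding_c1.
apply: funext => q; rewrite /opP /opS'; case: ifP => // nq.
case: eqP => [ev|_].
  by case: ifP => // /andP[/eqP qc /eqP ee]; move: nq; rewrite qc ee gc sc eqxx.
by case: ifP => // /avoiding_cons[gq sq _]; move: nq; rewrite gq sq eqxx.
Qed.

Lemma opS'S e m : opS' e (opS e m) = opP (rng e) m.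
Proof.
have [gc sc] := avoiding_c1.
apply: funext => q; rewrite /opP /opS' /opS; case: eqP => [ev|ev].
  case: ifP => [/andP[/eqP -> /eqP ->]|nq].
    by rewrite !eqxx gc sc eqxx /= mulKf // fracX_neq0.
  (* Uniqueness of the loop enters here: a basis path that continues an edge leaving [v0] is [c1],
     and the edge is [e1]. *)
  case: ifP => // /andP[gq /eqP sq]; have [ee qc] := avoiding_loop ev gq sq.
  by move: nq; rewrite ee qc !eqxx.
case: ifP => [gq|gq]; first by have [-> -> _] := avoiding_cons gq; rewrite /= gq !eqxx.
case: ifP => // /andP[gq' /eqP sq]; case/negP: gq.
case/and3P: gq' => Ws se sv; apply/and3P; split=> /=.
- by rewrite eqxx -sq.
- by rewrite -[walk_end _ _]/(walk_end (rng e) q) -sq.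
- by rewrite sv andbT; apply/eqP.
Qed.

Lemma opS'Sn e f m : e != f -> opS' e (opS f m) = fun=> 0.
Proof.
move=> ef; apply: funext => q; rewrite /opS' /opS.
have [ev|ev] := eqVneq (src e) v0; last first.
  rewrite /= (inj_eq Some_inj) (negbTE ef) andbF.
  case: eqP => [fv|_]; last by case: ifP.
  by rewrite if_same.
case: ifP => // /andP[_ /eqP ee]; rewrite -ee /= andbF [f == e]eq_sym (negbTE ef).
by rewrite if_same mulr0.
Qed.

(* Each basis path [q] starting at [w] factors through exactly one edge leaving
   [w]: its first one, or [e1] when [q] is trivial. *)
Lemma opCK2 w (A : seq (edge E)) m : uniq A -> (forall e, (e \in A) = (src e == w)) ->
  (fun q => \sum_(e <- A) opS e (opS' e m) q) = opP w m.
Proof.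
move=> uA AE; apply: funext => q; rewrite /opP.
have term e : src e = w -> opS e (opS' e m) q =
    if avoiding q && (start q == w) && (head e1 q == e) then m q else 0.
  move=> ew; rewrite /opS /opS'; have [ev|ev] := eqVneq (src e) v0.
    case: q => [|f q] /=.
      rewrite avoiding_nil -ew ev eqxx /= [e1 == e]eq_sym.
      have [ee|_] := eqVneq e e1; last by rewrite andbF.
      by rewrite !eqxx /= mulVKf // fracX_neq0.
    case: ifP => // /andP[/andP[gq /eqP fw] _].
    by have [_ _ /eqP[]] := avoiding_cons gq; rewrite fw -ew.
  case: q => [|f q] /=.
    by rewrite andbF -ew [v0 == _]eq_sym (negbTE ev) andbF.
  rewrite (inj_eq Some_inj); have [->|fe] := eqVneq f e; last by rewrite !andbF.
  by rewrite ew eqxx !andbT; case: (avoiding _).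
rewrite big_seq_cond (eq_bigr (fun e =>
    if avoiding q && (start q == w) && (head e1 q == e) then m q else 0)).
  rewrite -big_seq_cond; case: ifP => [/andP[gq sq]|_]; last by rewrite big1.
  rewrite (bigD1_seq (head e1 q)) //=; last first.
    rewrite AE -(eqP sq); case: q {gq sq term} => //=.
    by rewrite loop_src.
  rewrite eqxx big1 ?addr0 // => e.
  by rewrite eq_sym => /negbTE ->.
by move=> e /andP[]; rewrite AE => /eqP ew _; apply: term.
Qed.

Definition opd (d : edge (Defs.double E)) : M -> M :=
  match d with inl e => opS e | inr e => opS' e end.

Fixpoint act (v : vertex E) (s : seq (edge (Defs.double E))) (m : M) : M :=
  if s is d :: s' then opd d (act (rng d) s' m) else opP v m.

(** The scalars are taken in K(x), not only in [K], since the eigenvalue met in [not_exchange] lies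
    there. *)
Definition mlin (a : F) (m m' : M) : M := fun q => a * m q + m' q.

Lemma opP_lin v a m m' : opP v (mlin a m m') = mlin a (opP v m) (opP v m').
Proof.
by apply: funext => q; rewrite /opP /mlin; case: ifP; rewrite // mulr0 addr0.
Qed.

Lemma opd_lin d a m m' : opd d (mlin a m m') = mlin a (opd d m) (opd d m').
Proof.
apply: funext => q; case: d => e; rewrite /= /opS /opS' /mlin; case: ifP => _;
  case: ifP => _; ring.
Qed.

Lemma act_lin v s a m m' : act v s (mlin a m m') = mlin a (act v s m) (act v s m').
Proof. by elim: s v => [|d s IH] v /=; rewrite ?opP_lin // IH opd_lin. Qed.

Lemma mlin0 m : mlin (-1) m m = fun=> 0.
Proof. by apply: funext => q; rewrite /mlin mulN1r addNr. Qed.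

Lemma opd0 d : opd d (fun=> 0) = fun=> 0.
Proof. by have := opd_lin d (-1) (fun=> 0) (fun=> 0); rewrite !mlin0. Qed.

Lemma opP_opd (d : edge (Defs.double E)) m : opP (src d) (opd d m) = opd d m.
Proof. by case: d => e; [apply: opPS | apply: opPS']. Qed.

Lemma opP_act v s m : is_walk (E := Defs.double E) v s -> opP v (act v s m) = act v s m.
Proof.
case: s => [|d s] /=; first by rewrite opPP eqxx.
by case/andP=> /eqP <- _; apply: opP_opd.
Qed.

Lemma act_cat v s t m :
  is_walk (E := Defs.double E) (walk_end (E := Defs.double E) v s) t ->
  act v (s ++ t) m = act v s (act (walk_end (E := Defs.double E) v s) t m).
Proof.
elim: s v => [|d s IH] v /= Wt; first by rewrite opP_act.
by rewrite IH.
Qed.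

Lemma act_cat0 v s w t m : is_walk (E := Defs.double E) w t ->
  walk_end (E := Defs.double E) v s != w -> act v s (act w t m) = fun=> 0.
Proof.
move=> Wt; elim: s v => [|d s IH] v vw.
  by rewrite -(opP_act m Wt) /= opPP (negbTE vw).
by rewrite /= IH // opd0.
Qed.

Definition actp (p : gpath (Defs.double E)) : M -> M := act (path_src p) (path_edges p).

Lemma actp_cat p q m : actp p (actp q m) =
  if path_rng p == path_src q then actp (path_cat p q) m else fun=> 0.
Proof.
rewrite /actp; case: eqP => pq; last first.
  by apply: act_cat0; [exact: (valP q) | apply/eqP].
rewrite path_src_cat // /path_edges val_path_cat //= act_cat.
  by rewrite -/(path_rng p) pq.
by rewrite -/(path_rng p) pq; apply: (valP q).
Qed.

(* Over an abstract module for the same reason as [bilinear_assoc]. *)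
Lemma bilinear_action (V : lmodType K) (I : Type) (b : I -> V) (mul : V -> V -> V)
    (r : V -> M -> M) :
  (forall Q : V -> Prop, Q 0 -> (forall f g, Q f -> Q g -> Q (f + g)) ->
    (forall a f, Q f -> Q (a *: f)) -> (forall i, Q (b i)) -> forall f, Q f) ->
  left_distributive mul +%R -> right_distributive mul +%R ->
  (forall a f g, mul (a *: f) g = a *: mul f g) ->
  (forall a f g, mul f (a *: g) = a *: mul f g) ->
  (forall f, mul 0 f = 0) -> (forall f, mul f 0 = 0) ->
  (forall f g m q, r (f + g) m q = r f m q + r g m q) ->
  (forall a f m q, r (a *: f) m q = tofrac a%:P * r f m q) ->
  (forall m q, r 0 m q = 0) ->
  (forall f a m m', r f (mlin a m m') = mlin a (r f m) (r f m')) ->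
  (forall f, r f (fun=> 0) = fun=> 0) ->
  (forall i j m, r (mul (b i) (b j)) m = r (b i) (r (b j) m)) ->
  forall f g m, r (mul f g) m = r f (r g m).
Proof.
move=> ind mulDl mulDr mulZl mulZr mul0l mul0r rD rZ r0 rlin rM0 rb f g m.
elim/ind: f m => [|f f' IH IH'|a f IH|i] m.
- by apply: funext => q; rewrite mul0l !r0.
- by apply: funext => q; rewrite mulDl !rD IH IH'.
- by apply: funext => q; rewrite mulZl !rZ IH.
elim/ind: g m => [|g g' IH IH'|a g IH|j] m; last exact: rb.
- rewrite mul0r; have -> : r 0 m = fun=> 0 by apply: funext => q; rewrite r0.
  by rewrite rM0.
- have -> : r (g + g') m = mlin 1 (r g m) (r g' m).
    by apply: funext => q; rewrite rD /mlin mul1r.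
  rewrite rlin -IH -IH' mulDr; apply: funext => q.
  by rewrite rD /mlin mul1r.
- have -> : r (a *: g) m = mlin (tofrac a%:P) (r g m) (fun=> 0).
    by apply: funext => q; rewrite rZ /mlin addr0.
  rewrite rlin -IH rM0 mulZr; apply: funext => q.
  by rewrite rZ /mlin addr0.
Qed.

Local Notation KE := (path_algebra K (Defs.double E)).
Local Notation iota := (fun a : K => tofrac a%:P : F).

Definition rho (f : KE) (m : M) : M :=
  fun q => \sum_(p <- msupp f) iota f@_p * actp p m q.

Lemma rhoEw (d : {fset gpath (Defs.double E)}) f m q : (msupp f `<=` d)%fset ->
  rho f m q = \sum_(p <- d) iota f@_p * actp p m q.
Proof.
move=> le; apply: big_fset_incl => // p _ /mcoeff_outdom ->.
by rewrite polyC0 tofrac0 mul0r.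
Qed.

Lemma rhoD f g m q : rho (f + g) m q = rho f m q + rho g m q.
Proof.
set d := (msupp f `|` msupp g)%fset.
rewrite !(@rhoEw d) ?fsubsetUl ?fsubsetUr ?msuppD_le // -big_split.
by apply: eq_bigr => p _; rewrite mcoeffD polyCD tofracD mulrDl.
Qed.

Lemma rhoZ a f m q : rho (a *: f) m q = iota a * rho f m q.
Proof.
rewrite (@rhoEw (msupp f)) ?msuppZ_le // mulr_sumr; apply: eq_bigr => p _.
by rewrite mcoeffZ polyCM tofracM mulrA.
Qed.

Lemma rho_path p m : rho (path_elt K p) m = actp p m.
Proof.
apply: funext => q.
by rewrite /rho msupp_path_elt big_seq_fset1 mcoeff_path_elt eqxx tofrac1 mul1r.
Qed.

Lemma rho0 m q : rho 0 m q = 0.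
Proof. by rewrite -(scale0r (0 : KE)) rhoZ polyC0 tofrac0 mul0r. Qed.

Lemma rhoN f m q : rho (- f) m q = - rho f m q.
Proof. by rewrite -scaleN1r rhoZ polyCN tofracN tofrac1 mulN1r. Qed.

Lemma rhoB f g m q : rho (f - g) m q = rho f m q - rho g m q.
Proof. by rewrite rhoD rhoN. Qed.

Lemma rho_lin f a m m' : rho f (mlin a m m') = mlin a (rho f m) (rho f m').
Proof.
apply: funext => q; rewrite /mlin /rho mulr_sumr -big_split.
apply: eq_bigr => p _; rewrite /actp act_lin /mlin mulrDr.
by rewrite !mulrA [_ * a]mulrC.
Qed.

Lemma rhoM0 f : rho f (fun=> 0) = fun=> 0.
Proof. by have := rho_lin f (-1) (fun=> 0) (fun=> 0); rewrite !mlin0. Qed.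

Lemma rhoM f g m : rho (f ** g) m = rho f (rho g m).
Proof.
apply: (bilinear_action (@path_algebra_ind K (Defs.double E))) m => //.
- exact: rngmulDl.
- exact: rngmulDr.
- exact: path_scaleAl.
- exact: path_scaleAr.
- exact: rngmul0l.
- exact: rngmul0r.
- exact: rhoD.
- exact: rhoZ.
- exact: rho0.
- exact: rho_lin.
- exact: rhoM0.
move=> p r m; rewrite path_mulE path_mulUU !rho_path actp_cat /basis_mul.
case: eqP => _; first by rewrite rho_path.
by apply: funext => q; rewrite rho0.
Qed.

Lemma rho_vertex v m : rho (leavitt_vertex K v) m = opP v m.
Proof. exact: rho_path. Qed.

Lemma rho_edge e m : rho (leavitt_edge K e) m = opS e m.
Proof. by rewrite rho_path; apply: opSP. Qed.

Lemma rho_ghost e m : rho (leavitt_ghost K e) m = opS' e m.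
Proof. by rewrite rho_path; apply: opS'P. Qed.

Lemma rho_sum (I : Type) (r : seq I) (G : I -> KE) m q :
  rho (\sum_(i <- r) G i) m q = \sum_(i <- r) rho (G i) m q.
Proof.
elim: r => [|i r IH]; first by rewrite !big_nil rho0.
by rewrite !big_cons rhoD IH.
Qed.

Lemma rho_relator f m q : leavitt_relator f -> rho f m q = 0.
Proof.
case=> [e|e f' ef|w ns ni].
- rewrite rhoB rhoM rho_vertex rho_ghost rho_edge opS'S.
  by rewrite subrr.
- by rewrite rhoM rho_ghost rho_edge opS'Sn //; apply/eqP.
have fin : finite_set [set e : edge E | src e = w]%classic.
  by apply: contrapT.
rewrite fsbig_finite // rhoB rho_vertex rho_sum.
rewrite (eq_bigr (fun e => opS e (opS' e m) q)); last first.
  by move=> e _; rewrite rhoM rho_edge rho_ghost.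
rewrite -(@opCK2 w (fset_set [set e : edge E | src e = w]%classic) m) ?subrr //.
by move=> e; rewrite in_fset_set //; apply/idP/eqP; rewrite inE.
Qed.

Lemma rho_ideal f g m q : lpi f = lpi g -> rho f m q = rho g m q.
Proof.
move=> /lpi_eq fg; apply/eqP; rewrite -subr_eq0 -rhoB; apply/eqP.
pose I (h : KE) := forall m q, rho h m q = 0.
apply: (fg I); last by move=> h rh m' q'; apply: rho_relator.
split=> [m' q'|a b Ia Ib m' q'|a b Ib m' q'|a b Ib m' q'].
- exact: rho0.
- by rewrite rhoB Ia Ib subr0.
- rewrite rhoM; have -> : rho b m' = fun=> 0 by apply: funext => ?; apply: Ib.
  by rewrite rhoM0.
- by rewrite rhoM Ib.
Qed.

Lemma opd_laurent d m : (forall q, laurent (m q)) -> forall q, laurent (opd d m q).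
Proof.
have L0 : laurent (0 : F) by rewrite -(tofrac0 {poly K}); apply: laurent_poly.
move=> Lm q; case: d => e; rewrite /= /opS /opS'; do 2 case: ifP => // _.
  by apply: laurentM => //; apply: laurent_poly.
by apply: laurentM => //; apply: laurentV.
Qed.

Lemma act_laurent v s m : (forall q, laurent (m q)) ->
  forall q, laurent (act v s m q).
Proof.
have L0 : laurent (0 : F) by rewrite -(tofrac0 {poly K}); apply: laurent_poly.
move=> Lm; elim: s v => [|d s IH] v q; last exact: opd_laurent.
by rewrite /= /opP; case: ifP.
Qed.

Lemma rho_laurent f m : (forall q, laurent (m q)) -> forall q, laurent (rho f m q).
Proof.
move=> Lm q; apply: big_ind => [|g h|p _]; last 1 first.
- by apply: laurentM; [apply: laurent_poly | apply: act_laurent].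
- by rewrite -(tofrac0 {poly K}); apply: laurent_poly.
- exact: laurentD.
Qed.

Lemma act_avoiding s m : avoiding s -> act (start s) (map inl s) m s = m [::].
Proof.
elim: s => [|e s IH] gs /=; first by rewrite /opP avoiding_nil eqxx.
have [gs' <- ev] := avoiding_cons gs.
by rewrite /opS (negbTE ev) gs eqxx /= IH.
Qed.

Lemma is_walk_double (v : vertex E) (s : seq (edge E)) :
  is_walk (E := Defs.double E) v (map inl s) = is_walk v s.
Proof. by elim: s v => //= e s IH v; rewrite IH. Qed.

Lemma not_exchange : ~ exchange_ring (leavitt_path_algebra K E).
Proof.
have Wc : is_walk (E := Defs.double E) v0 (map inl (e1 :: c1)).
  by rewrite is_walk_double; case: loop.
pose c : KE := path_elt K (mkpath Wc).
have cE m q : rho c m q = if q == [::] then x * m [::] else 0.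
  rewrite rho_path /actp /= /opS loop_src eqxx eqxx andbT.
  have [gc <-] := avoiding_c1; by rewrite act_avoiding.
pose y : F := x + x ^+ 2.
pose X := c + c ** c.
have XE m q : rho X m q = if q == [::] then y * m [::] else 0.
  by rewrite rhoD rhoM !cE eqxx /y; case: (q == [::]); ring.
move=> /(_ (lpi X))[e [r [s []]]].
have [e' ->] := lpi_surj e; have [r' ->] := lpi_surj r; have [s' ->] := lpi_surj s.
rewrite -!lpiM => ee er; rewrite -lpiD -lpiB => es.
pose delta : M := fun q => (q == [::])%:R.
have Ld q : laurent (delta q).
  have -> : delta q = tofrac (q == [::])%:R; last exact: laurent_poly.
  by rewrite /delta; case: (q == [::]); rewrite ?tofrac1 ?tofrac0.
(* As e = X r and [X] projects to the trivial path, the image of [delta] under [e'] is a multiple of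
   [delta]. The idempotent thus acts on [delta] by an idempotent scalar of the field K(x). *)
have ed : rho e' delta = mlin (rho e' delta [::]) delta (fun=> 0).
  apply: funext => q; rewrite /mlin addr0 /delta.
  have E2 q' : rho e' delta q' = if q' == [::] then y * rho r' delta [::] else 0.
    by rewrite (rho_ideal _ _ er) rhoM XE.
  by rewrite -/delta !E2; case: eqP; rewrite ?mulr1 ?mulr0.
apply: (@laurent_not_suitable _ (rho e' delta [::]) (rho r' delta [::])
          (rho s' delta [::])).
- exact: rho_laurent.
- exact: rho_laurent.
- have := rho_ideal delta [::] ee; rewrite rhoM {1}ed rho_lin rhoM0.
  by rewrite /mlin addr0.
- by rewrite (rho_ideal _ _ er) rhoM XE.
- by rewrite {1}(rho_ideal _ _ es) rhoB rhoD rhoM !XE /= /delta eqxx mulr1.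
Qed.

End UniqueLoop.

Lemma exchange_conditionK (K : fieldType) (E : digraph) :
  exchange_ring (leavitt_path_algebra K E) -> conditionK E.
Proof.
move=> exL v [p [[sp pv] up]].
case: p => -[w s] /= W in sp pv up.
have wv : w = v := pv; subst w.
have ls : simple_loop v s by apply/(simple_loopP W).
case: s W sp pv up ls => [|e s] W sp pv up ls; first by case: ls.
apply: (not_exchange (K := K) ls _ exL) => t lt.
have Wt : is_walk v t by case: lt.
have := up (mkpath Wt) (proj1 (simple_loopP Wt) lt).
by move/(congr1 (@path_edges E)).
Qed.

Theorem theorem4p2 (K : fieldType) (E : digraph) :
  exchange_ring (leavitt_path_algebra K E) <-> conditionK E.
Proof.
by split=> [/exchange_conditionK|/conditionK_exchange]; apply.
Qed.
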